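(* Let $\theta\in(0,1)$ and $\alpha>1$ with $\alpha\theta>1$. The function $$u(x,t)=-\frac{1}{\pi x}\sum_{k=1}^{\infty}\frac{1}{k!}\sin\left(k\pi\frac{\alpha-1}{2\alpha}\right)\Gamma\left(1+\frac{k}{\theta\alpha}\right)\left(-\frac{x}{t^{\frac{1}{\theta\alpha}}}\right)^k,\qquad t>0,$$ (extended by continuity to $x=0$) is the fundamental solution to the fractional Cauchy problem $$\frac{\partial u}{\partial t}(x,t)={}_{x}D^{\alpha\theta}_{\theta}u(x,t),\qquad u(x,0)=\delta(x),$$ where ${}_{x}D^{\alpha\theta}_{\theta}$ is the Riesz-Feller operator of order $\alpha\theta$ and parameter $\theta$.
   Context: With $\mathcal{F}\{f\}(\gamma)=\int_{-\infty}^{+\infty}e^{i\gamma x}f(x)\,dx$, the Riesz-Feller operator ${}_xD^{a}_{\theta}$ of order $a>0$ is defined implicitly by $\mathcal{F}\{{}_{x}D^{a}_{\theta}f\}(\gamma)=-|\gamma|^{a}e^{\frac{i\pi\theta}{2}\operatorname{sgn}(\gamma)}\mathcal{F}\{f\}(\gamma)$; no upper bound on the order is imposed. Accordingly, the fundamental solution of the Cauchy problem is understood via the Fourier transform in $x$: it is the function $u(x,t)$ whose transform $\hat u(\gamma,t)=\mathcal{F}\{u(\cdot,t)\}(\gamma)$ satisfies $\partial_t\hat u(\gamma,t)=-|\gamma|^{\alpha\theta}e^{\frac{i\pi\theta}{2}\operatorname{sgn}(\gamma)}\hat u(\gamma,t)$ for $t>0$ and $\hat u(\gamma,0^+)=1$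 for all $\gamma\in\mathbb{R}$. *)

(* Defs.v *)
From mathcomp Require Import all_boot all_order all_algebra.
From mathcomp Require Import complex.
From mathcomp Require Import all_classical all_reals all_analysis.

Set Implicit Arguments.
Unset Strict Implicit.
Unset Printing Implicit Defensive.

Import Order.TTheory GRing.Theory Num.Theory.
Import numFieldNormedType.Exports.

Local Open Scope classical_set_scope.
Local Open Scope ring_scope.
Local Open Scope complex_scope.

(* Euler's integral of the second kind; meaningful for z > 0 only (Rintegral
   returns a junk value when the integral diverges). *)
Definition Gamma (R : realType) (z : R) : R :=
  \int[@lebesgue_measure R]_(x in `]0, +oo[) (x `^ (z - 1) * expR (- x)).

(* e^{iy} for real y *)
Definition expi (R : realType) (y : R) : R[i] := cos y +i* sin y.

Definition Cintegral (R : realType) (g : R -> R[i]) : R[i] :=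
  (\int[@lebesgue_measure R]_x complex.Re (g x)) +i*
  (\int[@lebesgue_measure R]_x complex.Im (g x)).

(* Meaningful for Lebesgue integrable f only; integrability is required
   explicitly in [is_fundamental_solution]. *)
Definition fourier (R : realType) (f : R -> R) (gamma : R) : R[i] :=
  Cintegral (fun x => expi (gamma * x) * (f x)%:C).

(* Fourier symbol of the Riesz-Feller operator of order a > 0 and parameter
   theta: F{D f} = riesz_feller_symbol a theta * F{f}.  Here 0 `^ a = 0. *)
Definition riesz_feller_symbol (R : realType) (a theta gamma : R) : R[i] :=
  - (`|gamma| `^ a)%:C * expi (pi * theta / 2 * Num.sg gamma).

(* g has derivative l at t, for g : R -> R[i] of a real variable; R[i] is a
   normed module over itself and not over R, so [is_derive] does not apply. *)
Definition has_Cderivative (R : realType) (g : R -> R[i]) (t : R) (l : R[i]) :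
    Prop :=
  (h^-1)%:C * (g (t + h) - g t) @[h --> 0^'] --> (l : R[i]^o).

(* u x t is the fundamental solution of
     d/dt u = D^a_theta u,  u(x,0) = delta(x),
   understood through the Fourier transform in x. *)
Definition is_fundamental_solution (R : realType) (a theta : R)
    (u : R -> R -> R) : Prop :=
  [/\ forall t, 0 < t ->
        (@lebesgue_measure R).-integrable setT (fun x => (u x t)%:E),
      forall gamma t, 0 < t ->
        has_Cderivative (fun s => fourier (fun x => u x s) gamma) t
          (riesz_feller_symbol a theta gamma * fourier (fun x => u x t) gamma)
    & forall gamma, fourier (fun x => u x t) gamma @[t --> 0^'+] --> (1 : R[i]^o)].

Definition u_term (R : realType) (alpha theta x t : R) (k : nat) : R :=
  (k`!%:R)^-1 * sin (k%:R * pi * ((alpha - 1) / (2 * alpha)))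
  * Gamma (1 + k%:R / (theta * alpha))
  * (- (x / t `^ (theta * alpha)^-1)) ^+ k.

Definition u_series (R : realType) (alpha theta x t : R) : R :=
  - (pi * x)^-1 * \big[+%R/0]_(1 <= k <oo) u_term alpha theta x t k.

Definition u_sol (R : realType) (alpha theta x t : R) : R :=
  if x == 0 then lim (u_series alpha theta y t @[y --> 0^'])
  else u_series alpha theta x t.

(* Main.v *)
Require Import Defs.
From mathcomp Require Import all_boot all_order all_algebra.
From mathcomp Require Import complex ring lra.
From mathcomp Require Import all_classical all_reals all_analysis.
From mathcomp Require Import measurable_realfun lebesgue_integral_under.

Import Order.TTheory GRing.Theory Num.Theory.
Import numFieldNormedType.Exports.

Local Open Scope classical_set_scope.
Local Open Scope ring_scope.

(* Put a = alpha * theta and phi = pi * theta / 2, so that cos phi > 0.  The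
   transform of the solution must be exp (t m(gamma)) with m(gamma) =
   - |gamma|^a e^{i phi sgn gamma}; its inverse transform is
     u(x, t) = 1/pi int_0^oo e^{- t cos phi g^a} cos (x g + t sin phi g^a) dg.
   Since a > 1, cos (x g + .) may be expanded in powers of x under the integral,
   and the resulting integrals are values of Gamma (contour rotation, done here
   by differentiating in phi): this gives the series.  Conversely, two
   integrations by parts, again thanks to a > 1, give u(x, t) = O (1/x^2), so
   that u is integrable and Fourier inversion, obtained by Abel summation and
   the Poisson kernel, returns exp (t m(gamma)). *)

(** * Integration over the half-line *)

(** All integrals are real, so complex exponentials are split beforehand, and a free phase [k]
    stands for the choice between cosine and sine: k = 0 and k = - pi / 2 give the real and
    imaginary parts of one formula. The hypothesis theta < 1 enters as cos phi > 0, that is, as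
    damping. The hypothesis a > 1 acts at both ends of the half-line. At infinity, g^a beats every
    linear function, so e^{|x| g} is integrable against the damping and dominates all Taylor partial
    sums. At 0, the second derivative of e^{-(p - iq) g^a} behaves like g^(a - 2), which is
    integrable exactly when a > 1; this permits the second integration by parts. The obstacle in the
    inversion is Fubini: once the kernel is written as an integral over g, the double integrand does
    not decay in x. A factor e^{- e x} restores absolute integrability and creates the Poisson
    kernel. The transform is Lipschitz at each point, again by a > 1, so the limit e -> 0 is a
    single dominated convergence. *)

Section dominated.
Set Implicit Arguments.
Unset Strict Implicit.
Context d (T : measurableType d) (R : realType).
Variables (mu : {measure set T -> \bar R}) (D : set T) (mD : measurable D).

Lemma dominated_integrable_real (f g : T -> R) :
  measurable_fun D f -> mu.-integrable D (EFin \o g) ->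
  (forall x, D x -> `|f x| <= g x) -> mu.-integrable D (EFin \o f).
Proof.
move=> mf ig fg; apply: (le_integrable mD _ _ ig).
  exact/measurable_EFinP.
by move=> x Dx /=; rewrite lee_fin (le_trans (fg x Dx))// ler_norm.
Qed.

Lemma cvg_Rintegral_dominated (f_ : nat -> T -> R) (f g : T -> R) :
  (forall n, measurable_fun D (f_ n)) ->
  (forall x, D x -> f_ n x @[n --> \oo] --> f x) ->
  mu.-integrable D (EFin \o g) ->
  (forall n x, D x -> `|f_ n x| <= g x) ->
  mu.-integrable D (EFin \o f) /\
  \int[mu]_(x in D) f_ n x @[n --> \oo] --> \int[mu]_(x in D) f x.
Proof.
move=> mf_ f_f ig f_g.
have mf : measurable_fun D f by exact: (measurable_fun_cvg mf_ f_f).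
have [||||| h1 _ h2] := @dominated_convergence _ T R mu D mD
   (fun n => EFin \o f_ n) (EFin \o f) (EFin \o g).
- by move=> n; exact/measurable_EFinP.
- exact/measurable_EFinP.
- apply/aeW => x Dx; apply: cvg_EFin; first exact: nearW.
  exact: f_f.
- exact: ig.
- by apply/aeW => x n Dx; rewrite lee_fin f_g.
split=> //; apply: fine_cvg; rewrite /Rintegral fineK; first exact: h2.
exact: integrable_fin_num.
Qed.

Lemma integrable_lamZ (k : R) (f : T -> R) : mu.-integrable D (EFin \o f) ->
  mu.-integrable D (EFin \o (fun x => k * f x)).
Proof. by move=> fi; exact: (integrableZl mD k fi). Qed.

Lemma integrable_lamD (f g : T -> R) : mu.-integrable D (EFin \o f) ->
  mu.-integrable D (EFin \o g) ->
  mu.-integrable D (EFin \o (fun x => f x + g x)).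
Proof. by move=> fi gi; exact: (integrableD mD fi gi). Qed.

End dominated.

Section half_line.
Set Implicit Arguments.
Unset Strict Implicit.
Context (R : realType).
Notation mu := (@lebesgue_measure R).
Implicit Types (f g F G : R -> R).

(** Carries results on compact segments over to the half-line. The endpoints are arbitrary sequences
    because a substitution [F] turns them into [F (a n)] and [F (b n)]. *)
Lemma cvg_Rintegral_exhaust f (a b : nat -> R) :
  mu.-integrable `]0, +oo[ (EFin \o f) ->
  (forall n, 0 < a n) -> a n @[n --> \oo] --> 0 -> b n @[n --> \oo] --> +oo ->
  \int[mu]_(x in `[a n, b n]) f x @[n --> \oo] -->
  \int[mu]_(x in `]0, +oo[) f x.
Proof.
move=> fi a0 acvg bcvg.
have E n : \int[mu]_(x in `[a n, b n]) f x =
    \int[mu]_(x in `]0, +oo[) (f \_ `[a n, b n]) x.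
  rewrite -Rintegral_mkcondr; congr Rintegral.
  apply/seteqP; split => x /=; rewrite !in_itv/= ?andbT.
    by move=> /andP[ax xb]; rewrite ax xb (lt_le_trans (a0 n)).
  by case.
under eq_fun do rewrite E.
have mf : measurable_fun (`]0, +oo[%classic : set R) f.
  by apply/measurable_EFinP; exact: (measurable_int mu).
have mD : measurable (`]0, +oo[%classic : set R) by [].
apply: (cvg_Rintegral_dominated (mu:=mu) (D:=`]0, +oo[) mD (f_:=fun n => f \_ `[a n, b n]) (f:=f) (g := fun x => `|f x|) _ _ _ _).2.
- move=> n; apply/(measurable_restrict f) => //.
  by apply: (measurable_funS _ _ mf) => //; exact: subIsetl.
- move=> x /=; rewrite in_itv/= andbT => x0.
  apply/cvgrPdist_lt => e e0; near=> n.
  rewrite patchE ifT ?subrr ?normr0//.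
  rewrite inE/= in_itv/=; apply/andP; split; apply: ltW.
    near: n; apply: (cvgr_lt 0) => //.
  by near: n; move/cvgryPgt : bcvg; exact.
- exact: integrable_norm.
- move=> n x _; rewrite patchE; case: ifP => // _.
  by rewrite normr0.
Unshelve. all: by end_near. Qed.

Lemma is_derive_continuous f (x l : R) : is_derive x 1 f l -> {for x, continuous f}.
Proof.
move=> [df _]; apply: differentiable_continuous.
exact/derivable1_diffP.
Qed.

Lemma Rintegral_itvcc_FTC f F a b : a < b ->
  (forall x, a <= x <= b -> {for x, continuous f}) ->
  (forall x, a <= x <= b -> is_derive x 1 F (f x)) ->
  \int[mu]_(x in `[a, b]) f x = F b - F a.
Proof.
move=> ab cf dF.
have cF x : a <= x <= b -> {for x, continuous F}.
  by move=> /dF; exact: is_derive_continuous.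
rewrite /Rintegral (@continuous_FTC2 _ f F a b)//.
- apply: continuous_in_subspaceT => x; rewrite inE/= in_itv/=; exact: cf.
- split.
  + by move=> x; rewrite in_itv/= => /andP[ax xb]; have [] := dF x; rewrite ?(ltW ax) ?(ltW xb).
  + by apply: cvg_at_right_filter; apply: cF; rewrite lexx ltW.
  + by apply: cvg_at_left_filter; apply: cF; rewrite lexx ltW.
- move=> x; rewrite in_itv/= => /andP[ax xb]; rewrite derive1E.
  by have [] := dF x; rewrite ?(ltW ax) ?(ltW xb).
Qed.

Lemma cvg_invSn : (n.+1%:R^-1 : R) @[n --> \oo] --> (0 : R).
Proof. exact: cvg_harmonic. Qed.

Lemma cvg_Sn_pinfty : (n.+2%:R : R) @[n --> \oo] --> +oo.
Proof.
under eq_fun do rewrite -addn2.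
have := @cvgr_idn R; rewrite -(cvg_shiftn 2); exact.
Qed.

Lemma Rintegral_half_line_FTC f F (A B : R) :
  (forall x : R, 0 < x -> {for x, continuous f}) ->
  (forall x : R, 0 < x -> is_derive x 1 F (f x)) ->
  mu.-integrable `]0, +oo[ (EFin \o f) ->
  F x @[x --> 0^'+] --> A -> F x @[x --> +oo] --> B ->
  \int[mu]_(x in `]0, +oo[) f x = B - A.
Proof.
move=> cf dF fi FA FB.
pose a n : R := n.+1%:R^-1.
(* The shift by 2 keeps [a n < b n] strict at n = 0, where a 0 = 1. *)
pose b n : R := n.+2%:R.
have h := cvg_Rintegral_exhaust (a:=a) fi (fun n => ltac:(by rewrite invr_gt0)) cvg_invSn cvg_Sn_pinfty.
apply: (cvg_unique _ h) => //.
have E n : \int[mu]_(x in `[a n, b n]) f x = F (b n) - F (a n).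
  have a0 x : a n <= x <= b n -> 0 < x.
    by move=> /andP[+ _]; apply: lt_le_trans; rewrite invr_gt0.
  apply: Rintegral_itvcc_FTC.
  - by rewrite (@le_lt_trans _ _ 1)// ?invf_le1// ?ler1n// ltr1n.
  - by move=> x /a0; exact: cf.
  - by move=> x /a0; exact: dF.
rewrite (_ : (fun n => _) = (fun n => F (b n) - F (a n))); last exact/funext.
apply: cvgB.
- apply: ((@cvg_pinftyP R F B).1 FB); exact: cvg_Sn_pinfty.
- apply: ((@cvg_at_rightP R F 0 A).1 FA); split; last exact: cvg_invSn.
  by move=> n; rewrite invr_gt0.
Qed.

Lemma measurable_half_line f : (forall x : R, 0 < x -> {for x, continuous f}) ->
  measurable_fun (`]0, +oo[%classic : set R) f.
Proof.
move=> cf; apply: open_continuous_measurable_fun => // x.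
by rewrite inE/= in_itv/= andbT; exact: cf.
Qed.

(** For a nonnegative integrand a bounded primitive is enough: each integral over [1/(n+1), n+2] is
    a difference of two values of [F], hence at most 2M, and monotone convergence reaches the
    union. *)
Lemma integrable_half_line_ge0 f F (M : R) :
  (forall x : R, 0 < x -> 0 <= f x) ->
  (forall x : R, 0 < x -> {for x, continuous f}) ->
  (forall x : R, 0 < x -> is_derive x 1 F (f x)) ->
  (forall x : R, 0 < x -> `|F x| <= M) ->
  mu.-integrable `]0, +oo[ (EFin \o f).
Proof.
move=> f0 cf dF FM; have mf := measurable_half_line cf.
apply/integrableP; split; first exact/measurable_EFinP.
pose E n := `[n.+1%:R^-1, n.+2%:R]%classic : set R.
have En n x : E n x -> 0 < x.
  by rewrite /E/= in_itv/= => /andP[+ _]; apply: lt_le_trans; rewrite invr_gt0.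
have UE : `]0, +oo[%classic = \bigcup_n E n.
  apply/seteqP; split => x /=; last by move=> [n _ /En]; rewrite in_itv/= andbT.
  rewrite in_itv/= andbT => x0.
  have : \forall n \near \oo, n.+1%:R^-1 < x by apply: (cvgr_lt 0) => //; exact: cvg_invSn.
  have : \forall n \near \oo, x < n.+2%:R by move/cvgryPgt : cvg_Sn_pinfty; exact.
  move=> h1 h2; near \oo => n; exists n => //; rewrite /E/= in_itv/=.
  by apply/andP; split; apply: ltW; near: n.
have c : (\int[mu]_(x in E n) `|(EFin \o f) x|)%E @[n --> \oo] -->
    (\int[mu]_(x in \bigcup_n E n) `|(EFin \o f) x|)%E.
  apply: ge0_nondecreasing_set_cvg_integral => //.
  - apply/nondecreasing_seqP => n; rewrite subsetEset /E; apply: subset_itv.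
      by rewrite bnd_simp lef_pV2 ?posrE// ler_nat.
    by rewrite bnd_simp ler_nat.
  - by move=> n; exact: measurable_itv.
  - move=> n; apply: measurableT_comp => //; apply/measurable_EFinP.
    apply: (measurable_funS _ _ mf) => // x /En; rewrite /= in_itv/= andbT//.
rewrite UE; apply: (@le_lt_trans _ _ (M + M)%:E); last by rewrite ltry.
rewrite -(cvg_lim _ c)//; apply: lime_le; first by apply/cvg_ex; eexists; exact: c.
apply: nearW => n.
have i01 : n.+1%:R^-1 < n.+2%:R :> R.
  by rewrite (@le_lt_trans _ _ 1)// ?invf_le1// ?ler1n// ltr1n.
rewrite (_ : (\int[mu]_(x in E n) _)%E = (\int[mu]_(x in E n) (EFin \o f) x)%E); last first.
  apply: eq_integral.
  by move=> x /set_mem /En x0 /=; rewrite ger0_norm// f0.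
have ci : mu.-integrable (E n) (EFin \o f).
  apply: continuous_compact_integrable.
    exact: segment_compact.
  by apply: continuous_in_subspaceT => x /set_mem /En; exact: cf.
have fin : (\int[mu]_(x in E n) (EFin \o f) x)%E \is a fin_num.
  by apply: integrable_fin_num; [exact: measurable_itv|exact: ci].
rewrite -(fineK fin) lee_fin.
have -> : fine (\int[mu]_(x in E n) (EFin \o f) x)%E = F n.+2%:R - F n.+1%:R^-1.
  apply: Rintegral_itvcc_FTC => // x xab.
    by apply: cf; apply: (En n); rewrite /E/= in_itv.
  by apply: dF; apply: (En n); rewrite /E/= in_itv.
rewrite (le_trans (ler_norm _))// (le_trans (ler_normB _ _))//.
by rewrite lerD// FM// invr_gt0.
Unshelve. all: by end_near. Qed.

Lemma Rintegral_half_line_subst g F f :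
  mu.-integrable `]0, +oo[ (EFin \o g) ->
  (forall x : R, 0 < x -> {for x, continuous g}) ->
  (forall x : R, 0 < x -> 0 < F x) ->
  (forall x y : R, 0 < x -> x < y -> F x < F y) ->
  (forall x : R, 0 < x -> is_derive x 1 F (f x)) ->
  (forall x : R, 0 < x -> {for x, continuous f}) ->
  F x @[x --> 0^'+] --> 0 -> F x @[x --> +oo] --> +oo ->
  mu.-integrable `]0, +oo[ (EFin \o (fun x => g (F x) * f x)) ->
  \int[mu]_(x in `]0, +oo[) g x = \int[mu]_(x in `]0, +oo[) (g (F x) * f x).
Proof.
move=> gi cg F0 Fincr dF cf F00 Foo gFi.
pose a n : R := n.+1%:R^-1.
pose b n : R := n.+2%:R.
have a0 n : 0 < a n by rewrite invr_gt0.
have aR : forall (l : R), F x @[x --> 0^'+] --> l -> F (a n) @[n --> \oo] --> l.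
  move=> l Fl; apply: ((@cvg_at_rightP R F 0 l).1 Fl).
  by split=> //; exact: cvg_invSn.
have bR : F (b n) @[n --> \oo] --> +oo.
  exact: (cvg_comp _ _ cvg_Sn_pinfty Foo).
have h1 := cvg_Rintegral_exhaust gFi a0 cvg_invSn cvg_Sn_pinfty.
have h2 := cvg_Rintegral_exhaust gi (fun n => F0 _ (a0 n)) (aR _ F00) bR.
apply: (cvg_unique _ h2) => //.
rewrite (_ : (fun n => _) =
  (fun n => \int[mu]_(x in `[a n, b n]) (g (F x) * f x))) //.
apply/funext => n.
have ab : a n < b n.
  by rewrite (@le_lt_trans _ _ 1)// ?invf_le1// ?ler1n// ltr1n.
have xp x : a n <= x <= b n -> 0 < x.
  by move=> /andP[+ _]; exact: lt_le_trans.
have DF (x : R) : 0 < x -> derive1 F x = f x.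
  by move=> /dF [_]; rewrite derive1E.
have near_eq (x : R) : 0 < x -> \forall y \near x, derive1 F y = f y.
  move=> x0; near=> y; apply: DF; near: y; exact: lt_nbhsr.
have cF (x : R) : 0 < x -> {for x, continuous F}.
  by move=> /dF; exact: is_derive_continuous.
have cF' (x : R) : 0 < x -> {for x, continuous (derive1 F)}.
  move=> x0; rewrite /prop_for /continuous_at DF//.
  apply: cvg_trans (cf _ x0); apply: near_eq_cvg.
  by near do apply/esym; exact: near_eq.
rewrite /Rintegral (@integration_by_substitution_increasing _ F g).
- congr fine; apply: eq_integral => x; rewrite inE/= in_itv/= => /xp x0.
  by rewrite /= -[LHS]/(g (F x) * derive1 F x)%:E DF.
- exact: ltW.
- by move=> x y; rewrite !in_itv/= => /xp x0 _; exact: Fincr.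
- by move=> x; rewrite in_itv/= => /andP[ax _]; apply: cF'; exact: lt_trans ax.
- apply/cvg_ex; exists (derive1 F (a n)); apply: cvg_at_right_filter; exact: cF'.
- apply/cvg_ex; exists (derive1 F (b n)); apply: cvg_at_left_filter; apply: cF'.
  exact: lt_trans ab.
- split.
  + move=> x; rewrite in_itv/= => /andP[ax _].
    by have [] := dF x (lt_trans (a0 n) ax).
  + by apply: cvg_at_right_filter; exact: cF.
  + by apply: cvg_at_left_filter; apply: cF; exact: lt_trans ab.
- apply: continuous_in_subspaceT => x; rewrite inE/= in_itv/= => /andP[ax _].
  by apply: cg; apply: lt_le_trans ax; exact: F0.
Unshelve. all: by end_near. Qed.

End half_line.

(** * Differentiation and continuity of explicit expressions *)

Section calculus.
Set Implicit Arguments.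
Unset Strict Implicit.
Context (R : realType).
Implicit Types (f g : R -> R) (x l m : R).

Lemma is_derive_eqr f x l m : is_derive x 1 f m -> m = l -> is_derive x 1 f l.
Proof. by move=> df <-. Qed.

Lemma is_derive_lamD f g x l m : is_derive x 1 f l -> is_derive x 1 g m ->
  is_derive x 1 (fun y => f y + g y) (l + m).
Proof. exact: is_deriveD. Qed.

Lemma is_derive_lamN f x l : is_derive x 1 f l ->
  is_derive x 1 (fun y => - f y) (- l).
Proof. exact: is_deriveN. Qed.

Lemma is_derive_lamM f g x l m : is_derive x 1 f l -> is_derive x 1 g m ->
  is_derive x 1 (fun y => f y * g y) (l * g x + f x * m).
Proof.
move=> df dg; have -> : l * g x + f x * m = f x *: m + g x *: l.
  by rewrite /GRing.scale/= addrC mulrC [l * _]mulrC mulrC.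
exact: is_deriveM.
Qed.

Lemma is_derive_lamV f x l : f x != 0 -> is_derive x 1 f l ->
  is_derive x 1 (fun y => (f y)^-1) (- (l / f x ^+ 2)).
Proof.
move=> f0 df; have -> : - (l / f x ^+ 2) = - (f x) ^- 2 *: l.
  by rewrite /GRing.scale/= mulNr mulrC.
exact: is_deriveV.
Qed.

Lemma is_derive_lam_expR f x l : is_derive x 1 f l ->
  is_derive x 1 (fun y => expR (f y)) (expR (f x) * l).
Proof. by move=> df; apply: is_derive1_comp. Qed.

Lemma is_derive_lam_cos f x l : is_derive x 1 f l ->
  is_derive x 1 (fun y => cos (f y)) (- sin (f x) * l).
Proof. by move=> df; apply: is_derive1_comp. Qed.

Lemma is_derive_lam_sin f x l : is_derive x 1 f l ->
  is_derive x 1 (fun y => sin (f y)) (cos (f x) * l).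
Proof. by move=> df; apply: is_derive1_comp. Qed.

Lemma is_derive_lam_atan f x l : is_derive x 1 f l ->
  is_derive x 1 (fun y => atan (f y)) ((1 + f x ^+ 2)^-1 * l).
Proof. by move=> df; apply: is_derive1_comp. Qed.

Lemma is_derive_lam_powR f x l r : 0 < f x -> is_derive x 1 f l ->
  is_derive x 1 (fun y => f y `^ r) (r * f x `^ (r - 1) * l).
Proof.
move=> fx0 df; have dp := is_derive1_powR r fx0.
exact: (is_derive1_comp dp df).
Qed.

Lemma is_derive_lam_exprn f x l n : is_derive x 1 f l ->
  is_derive x 1 (fun y => f y ^+ n) (n%:R * f x ^+ n.-1 * l).
Proof.
move=> df; have := is_deriveX n df; rewrite exprfctE; exact.
Qed.

Lemma continuous_lamD f g x : {for x, continuous f} -> {for x, continuous g} ->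
  {for x, continuous (fun y => f y + g y)}.
Proof. by move=> cf cg; apply: cvgD. Qed.

Lemma continuous_lamN f x : {for x, continuous f} ->
  {for x, continuous (fun y => - f y)}.
Proof. by move=> cf; apply: cvgN. Qed.

Lemma continuous_lamM f g x : {for x, continuous f} -> {for x, continuous g} ->
  {for x, continuous (fun y => f y * g y)}.
Proof. by move=> cf cg; apply: cvgM. Qed.

Lemma continuous_lamV f x : f x != 0 -> {for x, continuous f} ->
  {for x, continuous (fun y => (f y)^-1)}.
Proof. by move=> f0 cf; apply: cvgV. Qed.

Lemma continuous_lam_comp (h : R -> R) f x : {for x, continuous f} ->
  {for f x, continuous h} -> {for x, continuous (fun y => h (f y))}.
Proof. by move=> cf ch; apply: continuous_comp. Qed.

Lemma continuous_lam_powR f x r : 0 < f x -> {for x, continuous f} ->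
  {for x, continuous (fun y => f y `^ r)}.
Proof.
move=> f0 cf; have cp := is_derive_continuous (is_derive1_powR r f0).
exact: (continuous_lam_comp cf cp).
Qed.

Lemma continuous_lam_exprn f x n : {for x, continuous f} ->
  {for x, continuous (fun y => f y ^+ n)}.
Proof.
move=> cf; have cp := @exprn_continuous R n (f x).
exact: (continuous_lam_comp cf cp).
Qed.

End calculus.

(** Builds the derivative along the syntax of the function, leaving only nonzero denominators and
    positive bases of powers as side conditions. [derive_to_eq] then compares the result with the
    claimed derivative algebraically. *)
Ltac solve_derive :=
  cbv beta; lazymatch goal with |- is_derive _ _ ?F _ =>
  lazymatch F with
  | (fun _ => ?c) => notypeclasses refine (is_derive_cst c _ _)
  | (fun y => y) => notypeclasses refine (is_derive_id _ _)
  | (fun y => @GRing.add _ (@?f y) (@?g y)) =>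
      notypeclasses refine (@is_derive_lamD _ f g _ _ _ _ _); solve_derive
  | (fun y => @GRing.opp _ (@?f y)) =>
      notypeclasses refine (@is_derive_lamN _ f _ _ _); solve_derive
  | (fun y => @GRing.mul _ (@?f y) (@?g y)) =>
      notypeclasses refine (@is_derive_lamM _ f g _ _ _ _ _); solve_derive
  | (fun y => @GRing.inv _ (@?f y)) =>
      notypeclasses refine (@is_derive_lamV _ f _ _ _ _); [ | solve_derive]
  | (fun y => @expR _ (@?f y)) =>
      notypeclasses refine (@is_derive_lam_expR _ f _ _ _); solve_derive
  | (fun y => @cos _ (@?f y)) =>
      notypeclasses refine (@is_derive_lam_cos _ f _ _ _); solve_derive
  | (fun y => @sin _ (@?f y)) =>
      notypeclasses refine (@is_derive_lam_sin _ f _ _ _); solve_derive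
  | (fun y => @atan _ (@?f y)) =>
      notypeclasses refine (@is_derive_lam_atan _ f _ _ _); solve_derive
  | (fun y => @powR _ (@?f y) ?r) =>
      notypeclasses refine (@is_derive_lam_powR _ f _ _ r _ _); [ | solve_derive]
  | (fun y => @GRing.exp _ (@?f y) ?n) =>
      notypeclasses refine (@is_derive_lam_exprn _ f _ _ n _); solve_derive
  | _ => idtac
  end end.

Ltac derive_to_eq :=
  notypeclasses refine (@is_derive_eqr _ _ _ _ _ _ _); [solve_derive | ].

Ltac solve_continuous :=
  cbv beta; lazymatch goal with |- {for _, continuous ?F} =>
  lazymatch F with
  | (fun _ => ?c) => notypeclasses refine (@cst_continuous _ _ c _)
  | (fun y => y) => exact: cvg_id
  | (fun y => @GRing.add _ (@?f y) (@?g y)) =>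
      notypeclasses refine (@continuous_lamD _ f g _ _ _); solve_continuous
  | (fun y => @GRing.opp _ (@?f y)) =>
      notypeclasses refine (@continuous_lamN _ f _ _); solve_continuous
  | (fun y => @GRing.mul _ (@?f y) (@?g y)) =>
      notypeclasses refine (@continuous_lamM _ f g _ _ _); solve_continuous
  | (fun y => @GRing.inv _ (@?f y)) =>
      notypeclasses refine (@continuous_lamV _ f _ _ _); [ | solve_continuous]
  | (fun y => @expR _ (@?f y)) =>
      notypeclasses refine (@continuous_lam_comp _ (@expR _) f _ _ _);
      [solve_continuous | exact: continuous_expR]
  | (fun y => @cos _ (@?f y)) =>
      notypeclasses refine (@continuous_lam_comp _ (@cos _) f _ _ _);
      [solve_continuous | exact: continuous_cos]
  | (fun y => @sin _ (@?f y)) =>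
      notypeclasses refine (@continuous_lam_comp _ (@sin _) f _ _ _);
      [solve_continuous | exact: continuous_sin]
  | (fun y => @powR _ (@?f y) ?r) =>
      notypeclasses refine (@continuous_lam_powR _ f _ r _ _); [ | solve_continuous]
  | (fun y => @GRing.exp _ (@?f y) ?n) =>
      notypeclasses refine (@continuous_lam_exprn _ f _ n _); solve_continuous
  | _ => idtac
  end end.

(** * Powers times exponentials *)

Section power_exponential.
Set Implicit Arguments.
Unset Strict Implicit.
Context (R : realType).
Notation mu := (@lebesgue_measure R).
Implicit Types (a c d p q r x y : R).

(** The majorant x^(d-1) (1+x)^(-(d+1)) is the derivative of the bounded function d^-1 (x/(1+x))^d;
    it controls the singularity at 0 and the tail at once, for every d > 0. *)
Lemma integrable_powR_expRN d c : 0 < d -> 0 < c ->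
  mu.-integrable `]0, +oo[ (EFin \o (fun x : R => x `^ (d - 1) * expR (- (c * x)))).
Proof.
move=> d0 c0.
pose k := d + 1; have k0 : 0 < k by rewrite /k; lra.
(* Chosen so that 1 + x <= K (1 + c x / k) <= K e^{c x / k}; the k-th power is (1 + x)^k <= K^k e^{c
   x}. *)
pose K := 1 + k / c; have K0 : 0 < K by rewrite /K ltr_wpDr// divr_ge0// ltW.
pose g x := (x `^ (d - 1) * (1 + x) `^ (- (d + 1)))%R.
have x1 x : 0 < x -> 0 < 1 + x by move=> ?; rewrite addr_gt0.
have gi : mu.-integrable `]0, +oo[ (EFin \o g).
  pose F x := (d^-1 * (x `^ d * (1 + x) `^ (- d)))%R.
  apply: (@integrable_half_line_ge0 R g F d^-1).
  - by move=> x x0; rewrite mulr_ge0// powR_ge0.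
  - by move=> x x0; rewrite /g; solve_continuous => //; exact: x1.
  - move=> x x0; rewrite /F; apply: is_derive_eq.
      solve_derive => //=; exact: x1.
    have E1 : x `^ d = x * x `^ (d - 1) by rewrite mulr_powRB1// ltW.
    have E2 : (1 + x) `^ (- d) = (1 + x) * (1 + x) `^ (- (d + 1)).
      rewrite -[X in X * _]powRr1 ?(ltW (x1 _ x0))// -powRD; last first.
        by rewrite (gt_eqF (x1 _ x0)) implybT.
      by congr (_ `^ _); ring.
    rewrite /= /g E1 E2 (_ : - d - 1 = - (d + 1)); last by ring.
    by field; rewrite gt_eqF.
  - move=> x x0; rewrite /F ger0_norm; last first.
      by rewrite !mulr_ge0 ?powR_ge0// invr_ge0 ltW.
    rewrite ler_piMr ?invr_ge0 ?(ltW d0)// powRN ler_pdivrMr ?mul1r; last first.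
      by apply: powR_gt0; exact: x1.
    apply: ge0_ler_powR; rewrite ?nnegrE ?(ltW d0) ?(ltW x0) ?(ltW (x1 _ x0))//.
    by rewrite lerDr.
apply: (@dominated_integrable_real _ _ R mu _ _ _ (fun x => K `^ k * g x)) => //.
- by apply: measurable_half_line => x x0; solve_continuous.
- exact: integrable_lamZ.
- move=> x /=; rewrite in_itv/= andbT => x0.
  rewrite ger0_norm ?mulr_ge0 ?powR_ge0 ?expR_ge0//.
  rewrite /g mulrCA ler_wpM2l ?powR_ge0//.
  rewrite powRN ler_pdivlMr ?powR_gt0 ?x1// expRN mulrC.
  rewrite ler_pdivrMr ?expR_gt0//.
  have -> : expR (c * x) = (expR (c * x / k)) `^ k.
    by rewrite -expRM; congr expR; field; rewrite gt_eqF.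
  rewrite -powRM ?(ltW K0) ?expR_ge0//.
  apply: ge0_ler_powR; rewrite ?nnegrE ?(ltW k0) ?(ltW (x1 _ x0)) ?mulr_ge0 ?expR_ge0 ?(ltW K0)//.
  apply: (@le_trans _ _ (K * (1 + c * x / k))).
    have -> : K * (1 + c * x / k) = 1 + x + (k / c + c * x / k).
      by rewrite /K; field; rewrite !gt_eqF.
    by rewrite lerDl addr_ge0// divr_ge0 ?mulr_ge0 ?ltW.
  by rewrite ler_pM2l// expR_ge1Dx.
Qed.

Lemma linear_sub_powR_ubound a p y : 1 < a -> 0 < p ->
  exists M : R, forall x, 0 < x -> y * x - p * x `^ a <= M.
Proof.
move=> a1 p0; have [y0|y0] := lerP y 0.
  exists 0 => x x0; rewrite subr_le0 (@le_trans _ _ 0)//.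
    by rewrite mulr_le0_ge0// ltW.
  by rewrite mulr_ge0 ?powR_ge0// ltW.
have a10 : 0 < a - 1 by rewrite subr_gt0.
(* The positive zero of y x - p x^a: beyond it the difference is nonpositive, before it y x alone is
   at most y z. *)
pose z := (y / p) `^ (a - 1)^-1.
exists (y * z) => x x0; have [xz|zx] := lerP x z.
  rewrite lerBlDr (@le_trans _ _ (y * z))// ?ler_wpM2l ?(ltW y0)//.
  by rewrite lerDl mulr_ge0 ?powR_ge0// ltW.
apply: (@le_trans _ _ 0); last by rewrite mulr_ge0 ?powR_ge0// ltW.
rewrite subr_le0 -(mulr_powRB1 (ltW x0) (lt_trans ltr01 a1)) mulrCA mulrC.
rewrite ler_wpM2l ?(ltW x0)// -ler_pdivrMl// mulrC.
have -> : y / p = z `^ (a - 1).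
  by rewrite /z -powRrM mulVf ?gt_eqF// powRr1// divr_ge0// ltW.
by apply: ge0_ler_powR; rewrite ?nnegrE ?powR_ge0 ?(ltW zx) ?(ltW x0)// ltW.
Qed.

Lemma integrable_powR_expR_powR a d p y : 1 < a -> 0 < d -> 0 < p ->
  mu.-integrable `]0, +oo[
    (EFin \o (fun x : R => x `^ (d - 1) * expR (y * x - p * x `^ a))).
Proof.
(* The extra unit of slope leaves a factor e^{-x} in the bound, which is integrable against
   x^(d-1). *)
move=> a1 d0 p0; have [M HM] := @linear_sub_powR_ubound a p (y + 1) a1 p0.
apply: (@dominated_integrable_real _ _ R mu _ _ _
  (fun x => expR M * (x `^ (d - 1) * expR (- (1 * x))))) => //.
- by apply: measurable_half_line => x x0; solve_continuous.
- apply: integrable_lamZ => //; exact: integrable_powR_expRN.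
- move=> x /=; rewrite in_itv/= andbT => x0.
  rewrite ger0_norm ?mulr_ge0 ?powR_ge0 ?expR_ge0//.
  rewrite mulrCA ler_wpM2l ?powR_ge0// -expRD ler_expR.
  by rewrite -lerBlDr mul1r opprK; have := HM _ x0; lra.
Qed.

Lemma cvg_powR_expR_powR_pinfty a p r : 1 < a -> 0 < p ->
  x `^ r * expR (- (p * x `^ a)) @[x --> +oo] --> (0 : R).
Proof.
(* For x >= 1 the power x^r is at most e^{|r| x}, because ln x <= x; the additional 1 is the
   remaining rate of decay. *)
move=> a1 p0; have [M HM] := @linear_sub_powR_ubound a p (`|r| + 1) a1 p0.
apply: (@squeeze_cvgr _ _ _ _ (cst 0) (fun x => expR M * expR (- x))).
- near=> x; have x1 : 1 <= x by near: x; exact: nbhs_pinfty_ge.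
  have x0 : 0 < x by exact: lt_le_trans x1.
  rewrite mulr_ge0 ?powR_ge0 ?expR_ge0//= /powR gt_eqF// -!expRD ler_expR.
  have := HM x x0; rewrite /powR gt_eqF//.
  have : r * ln x <= `|r| * x.
    rewrite (@le_trans _ _ (`|r| * ln x))//.
      by rewrite ler_wpM2r ?ln_ge0// ler_norm.
    by rewrite ler_wpM2l// (ltW (ln_sublinear _)).
  lra.
- exact: cvg_cst.
- rewrite -[X in _ --> X](mulr0 (expR M)).
  by apply: cvgM; [exact: cvg_cst|exact: cvgr_expR].
Unshelve. all: by end_near. Qed.

End power_exponential.

(** * Gamma integrals along rotated rays *)

Section damped_oscillation.
Set Implicit Arguments.
Unset Strict Implicit.
Context (R : realType).
Notation mu := (@lebesgue_measure R).
Implicit Types (a d p q r x y t : R).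

Lemma powRD_gt0 x r q : 0 < x -> x `^ (r + q) = x `^ r * x `^ q.
Proof. by move=> x0; rewrite powRD// (gt_eqF x0) implybT. Qed.

Lemma is_derive_Rintegral (f df : R -> R -> R) (G : R -> R) (u v z : R) :
  u < z < v ->
  (forall s, u < s < v -> mu.-integrable `]0, +oo[ (EFin \o f s)) ->
  (forall s x, u < s < v -> 0 < x -> is_derive s 1 (f ^~ x) (df s x)) ->
  (forall x, 0 <= G x) -> mu.-integrable `]0, +oo[ (EFin \o G) ->
  (forall s x, u < s < v -> 0 < x -> `|df s x| <= G x) ->
  is_derive z 1 (fun s => \int[mu]_(x in `]0, +oo[) f s x)
    (\int[mu]_(x in `]0, +oo[) df z x).
Proof.
move=> uzv fi dfE G0 Gi dfG.
have mD : measurable (`]0, +oo[%classic : set (measurableTypeR R)) by exact: measurable_itv.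
have E s x : u < s < v -> 0 < x -> partial1of2 f s x = df s x.
  by move=> us x0; rewrite partial1of2E; have [] := dfE s x us x0.
have pos (x : R) : `]0, +oo[%classic x -> 0 < x by rewrite /= in_itv/= andbT.
have zI : `]u, v[%classic z by rewrite /= in_itv.
have h1 s : `]u, v[%classic s -> mu.-integrable `]0, +oo[ (EFin \o f s).
  by rewrite /= in_itv; exact: fi.
have h2 s x : `]u, v[%classic s -> `]0, +oo[%classic x -> derivable (f ^~ x) s 1.
  by rewrite /= in_itv/= => us /pos x0; have [] := dfE s x us x0.
have h3 s x : `]u, v[%classic s -> `]0, +oo[%classic x -> `|partial1of2 f s x| <= G x.
  by rewrite /= in_itv/= => us /pos x0; rewrite E// dfG.
apply: DeriveDef.
  exact: (derivable_under_integral mD zI h1 h2 G0 Gi h3).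
rewrite -derive1E (differentiation_under_integral mD zI h1 h2 G0 Gi h3).
by apply: eq_Rintegral => x /set_mem /pos x0; rewrite E.
Qed.

Lemma integrable_damped a d p (h : R -> R) (M : R) : 1 < a -> 0 < d -> 0 < p ->
  (forall x, 0 < x -> {for x, continuous h}) -> (forall x, `|h x| <= M) ->
  mu.-integrable `]0, +oo[
    (EFin \o (fun x : R => x `^ (d - 1) * expR (- (p * x `^ a)) * h x)).
Proof.
move=> a1 d0 p0 ch hM.
apply: (@dominated_integrable_real _ _ R mu _ _ _
  (fun x => M * (x `^ (d - 1) * expR (0 * x - p * x `^ a)))) => //.
- apply: measurable_half_line => x x0; solve_continuous => //; exact: ch.
- by apply: integrable_lamZ => //; exact: integrable_powR_expR_powR.
- move=> x /=; rewrite in_itv/= andbT => x0.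
  rewrite normrM ger0_norm ?mulr_ge0 ?powR_ge0 ?expR_ge0// mulrC mul0r sub0r.
  by rewrite ler_wpM2r ?mulr_ge0 ?powR_ge0 ?expR_ge0.
Qed.

Lemma cvg0_bounded (T : Type) (F : set_system T) {FF : Filter F} (f h : T -> R) (M : R) :
  f z @[z --> F] --> 0 -> (forall z, `|h z| <= M) ->
  f z * h z @[z --> F] --> 0.
Proof.
move=> f0 hM; apply/cvgr0Pnorm_le => e e0.
have eM : 0 < e / (`|M| + 1) by rewrite divr_gt0// ltr_wpDl.
move/cvgr0Pnorm_le : f0 => /(_ _ eM); apply: filterS => z fz.
rewrite normrM (@le_trans _ _ (e / (`|M| + 1) * `|M|))//.
  by rewrite ler_pM// (le_trans (hM z))// ler_norm.
by rewrite mulrAC ler_pdivrMr ?ltr_wpDl// ler_pM2l// lerDl.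
Qed.

Lemma integrable_damped_ibp a d p q k : 1 < a -> 0 < d -> 0 < p ->
  mu.-integrable `]0, +oo[ (EFin \o (fun x => x `^ (d - 1) * expR (- (p * x `^ a)) *
    ((d - a * p * x `^ a) * sin (q * x `^ a + k)
      + a * q * x `^ a * cos (q * x `^ a + k)))).
Proof.
move=> a1 d0 p0; have a0 : 0 < a by exact: lt_trans a1.
pose s1 x := sin (q * x `^ a + k); pose c1 x := cos (q * x `^ a + k).
have cs1 x : 0 < x -> {for x, continuous s1}.
  by move=> x0; rewrite /s1; solve_continuous.
have cc1 x : 0 < x -> {for x, continuous c1}.
  by move=> x0; rewrite /c1; solve_continuous.
have ad0 : 0 < d + a by rewrite addr_gt0.
have i1 := integrable_damped a1 d0 p0 cs1 (fun x => sin_max _).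
have i2 := integrable_damped a1 ad0 p0 cs1 (fun x => sin_max _).
have i3 := integrable_damped a1 ad0 p0 cc1 (fun x => cos_max _).
have mD : measurable (`]0, +oo[%classic : set (measurableTypeR R)) by exact: measurable_itv.
have := integrable_lamD mD (integrable_lamD mD (integrable_lamZ mD d i1)
  (integrable_lamZ mD (- (a * p)) i2)) (integrable_lamZ mD (a * q) i3).
apply: eq_integrable => // x /[!inE]/=; rewrite in_itv/= andbT => x0.
congr EFin; rewrite /s1 /c1.
have -> : x `^ (d + a - 1) = x `^ (d - 1) * x `^ a.
  by rewrite -powRD_gt0//; congr (_ `^ _); ring.
ring.
Qed.

(** The integrand is the derivative of x^d e^{-p x^a} sin (q x^a + k), which vanishes at both ends.
    For q = 0 and k = pi / 2 this is the functional equation of Gamma; for p = t cos s and q = t sin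
    s it says that the integral along a rotated ray is stationary in the angle s. *)
Lemma damped_ibp a d p q k : 1 < a -> 0 < d -> 0 < p ->
  \int[mu]_(x in `]0, +oo[) (x `^ (d - 1) * expR (- (p * x `^ a)) *
    ((d - a * p * x `^ a) * sin (q * x `^ a + k)
      + a * q * x `^ a * cos (q * x `^ a + k))) = 0.
Proof.
move=> a1 d0 p0; pose F x := x `^ d * expR (- (p * x `^ a)) * sin (q * x `^ a + k).
have a0 : 0 < a by exact: lt_trans a1.
have pw x : 0 < x -> x `^ d * x `^ (a - 1) = x `^ (d - 1) * x `^ a.
  by move=> x0; rewrite -!powRD_gt0//; congr (_ `^ _); ring.
rewrite -[RHS](subrr 0); apply: (@Rintegral_half_line_FTC _ _ F).
- move=> x x0; solve_continuous => //.
- move=> x x0; rewrite /F; derive_to_eq => //.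
  rewrite /=.
  have := pw x x0; set A := x `^ d; set B := x `^ (a - 1).
  set C := x `^ (d - 1); set X := x `^ a; set E := expR _ => pwx.
  rewrite !(mul0r, add0r, addr0, mulr1).
  transitivity (E * d * C * sin (q * X + k) +
    A * B * (E * a * (q * cos (q * X + k) - p * sin (q * X + k)))); first ring.
  rewrite pwx; ring.
- exact: integrable_damped_ibp.
- apply: cvg0_bounded (fun x => sin_max _).
  apply: (@cvg0_bounded _ _ _ _ _ 1); first exact: powR_cvg0.
  move=> x; rewrite ger0_norm ?expR_ge0// expR_le1 oppr_le0.
  by rewrite mulr_ge0 ?powR_ge0// ltW.
- apply: cvg0_bounded (fun x => sin_max _).
  exact: cvg_powR_expR_powR_pinfty.
Qed.

Lemma damped_Gamma a d t : 1 < a -> 0 < d -> 0 < t ->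
  \int[mu]_(x in `]0, +oo[) (x `^ (d - 1) * expR (- (t * x `^ a))) =
  Gamma (1 + d / a) / d / t `^ (d / a).
Proof.
move=> a1 d0 t0; have a0 : 0 < a by exact: lt_trans a1.
have mD : measurable (`]0, +oo[%classic : set (measurableTypeR R)) by exact: measurable_itv.
have b0 : 0 < d / a by rewrite divr_gt0.
have ad0 : 0 < d + a by rewrite addr_gt0.
have c1 x : 0 < x -> {for x, continuous (fun=> 1 : R)}.
  by move=> _; exact: cst_continuous.
have n1 (x : R) : `|(fun=> 1 : R) x| <= 1 by rewrite normr1.
have i1 := integrable_damped a1 d0 t0 c1 n1.
have i2 := integrable_damped a1 ad0 t0 c1 n1.
have pd x : 0 < x -> x `^ (d + a - 1) = x `^ (d - 1) * x `^ a.
  by move=> x0; rewrite -powRD_gt0//; congr (_ `^ _); ring.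
(* Substituting in Gamma (1 + d / a) produces the exponent d + a - 1; this functional equation
   lowers it to d - 1 and is the origin of the division by d. *)
have E1 : d * \int[mu]_(x in `]0, +oo[) (x `^ (d - 1) * expR (- (t * x `^ a)) * 1) =
  a * t * \int[mu]_(x in `]0, +oo[) (x `^ (d + a - 1) * expR (- (t * x `^ a)) * 1).
  apply/eqP; rewrite -subr_eq0 -!RintegralZl// -RintegralB//; last 2 first.
  - exact: integrable_lamZ.
  - exact: integrable_lamZ.
  apply/eqP; rewrite -[RHS](@damped_ibp a d t 0 (pi / 2) a1 d0 t0).
  apply: eq_Rintegral => x /[!inE]/=; rewrite in_itv/= andbT => x0.
  by rewrite pd// mul0r add0r cos_pihalf sin_pihalf; ring.
have E2 : Gamma (1 + d / a) = t `^ (d / a) * (a * t *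
   \int[mu]_(x in `]0, +oo[) (x `^ (d + a - 1) * expR (- (t * x `^ a)) * 1)).
  pose g y := y `^ (1 + d / a - 1) * expR (- y).
  pose F x := t * x `^ a.
  pose f x := t * (a * x `^ (a - 1)).
  have Ef x : 0 < x -> g (F x) * f x =
      t `^ (d / a) * (a * t) * (x `^ (d + a - 1) * expR (- (t * x `^ a)) * 1).
    move=> x0; rewrite /g /F /f (_ : 1 + d / a - 1 = d / a); last by ring.
    rewrite powRM ?powR_ge0 ?(ltW t0)// -powRrM (_ : a * (d / a) = d); last first.
      by field; rewrite gt_eqF.
    rewrite (_ : d + a - 1 = d + (a - 1)); last by ring.
    by rewrite (powRD_gt0 d (a - 1) x0); ring.
  rewrite mulrA -RintegralZl//.
  transitivity (\int[mu]_(x in `]0, +oo[) (g (F x) * f x)); last first.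
    by apply: eq_Rintegral => x /[!inE]/=; rewrite in_itv/= andbT; exact: Ef.
  apply: (@Rintegral_half_line_subst _ g F f).
  - have b10 : 0 < 1 + d / a by rewrite addr_gt0.
    have := integrable_powR_expRN b10 (@ltr01 R); apply: eq_integrable => //.
    by move=> x _; rewrite /g /= mul1r.
  - by move=> x x0; rewrite /g; solve_continuous.
  - by move=> x x0; rewrite mulr_gt0// powR_gt0.
  - move=> x y x0 xy; rewrite /F ltr_pM2l//.
    by apply: gt0_ltr_powR; rewrite ?nnegrE ?(ltW x0) ?(ltW (lt_trans x0 xy)).
  - move=> x x0; rewrite /F; derive_to_eq => //.
    by rewrite /= /f; ring.
  - by move=> x x0; rewrite /f; solve_continuous.
  - rewrite -[X in _ --> X](mulr0 t).
    by apply: cvgM; [exact: cvg_cst|exact: powR_cvg0].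
  - apply/cvgryPge => A; near=> x.
    have x1 : 1 <= x by near: x; exact: nbhs_pinfty_ge.
    rewrite /F -ler_pdivrMl//; apply: (@le_trans _ _ x).
      by near: x; apply: nbhs_pinfty_ge; rewrite num_real.
    exact: le1r_powR x1 (ltW a1).
  - have := integrable_lamZ mD (t `^ (d / a) * (a * t)) i2.
    apply: eq_integrable => // x /[!inE]/=; rewrite in_itv/= andbT => x0.
    by congr EFin; rewrite Ef.
rewrite E2 -E1.
under [in RHS]eq_Rintegral do rewrite mulr1.
by field; rewrite !gt_eqF// powR_gt0.
Unshelve. all: by end_near. Qed.

Lemma ltr_cos_centered (v s : R) : 0 < v < pi -> - v < s < v -> cos v < cos s.
Proof.
move=> /andP[v0 vpi] vs; have sv : `|s| < v by rewrite ltr_norml.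
by rewrite -(cos_norm s) ltr_cos// in_itv/= ?normr_ge0 ?(ltW v0) ?(ltW vpi)// ltW// (lt_trans sv).
Qed.

(* Replaces the rotation of the contour of Euler's integral: the derivative of
   the left-hand side in phi is, up to the factor 1/a, the exact integrand of
   [damped_ibp], hence the integral does not depend on phi. *)
Lemma damped_cos_Gamma a d t (phi k : R) : 1 < a -> 0 < d -> 0 < t ->
  0 <= phi -> phi < pi / 2 ->
  \int[mu]_(x in `]0, +oo[) (x `^ (d - 1) * expR (- (t * cos phi * x `^ a)) *
    cos (t * sin phi * x `^ a - d / a * phi + k)) =
  cos k * (Gamma (1 + d / a) / d / t `^ (d / a)).
Proof.
move=> a1 d0 t0 phi0 phi1; have a0 : 0 < a by exact: lt_trans a1.
have mD : measurable (`]0, +oo[%classic : set (measurableTypeR R)) by exact: measurable_itv.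
have ad0 : 0 < d + a by rewrite addr_gt0.
have pi0 := pi_gt0 R.
(* The angle will range over the open interval (-v, v), which contains both 0 and [phi]. The damping
   rate t cos s stays above t cos v > 0 there, so one majorant serves all angles. *)
pose v := (phi + pi / 2) / 2.
have v0 : 0 < v by rewrite /v; lra.
have vpi2 : v < pi / 2 by rewrite /v; lra.
have phiv : phi < v by rewrite /v; lra.
have c0 : 0 < cos v by apply: cos_gt0_pihalf; lra.
have vpi : v < pi by lra.
have cosv (s : R) : - v < s < v -> cos v < cos s.
  by apply: ltr_cos_centered; rewrite v0.
pose f (s x : R) := x `^ (d - 1) * expR (- (t * cos s * x `^ a)) *
  cos (t * sin s * x `^ a - d / a * s + k).
pose H s := \int[mu]_(x in `]0, +oo[) f s x.
have one (x : R) : 0 < x -> {for x, continuous (fun=> 1 : R)}.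
  by move=> _; exact: cst_continuous.
have n1 (x : R) : `|(fun=> 1 : R) x| <= 1 by rewrite normr1.
have H0 : H 0 = cos k * (Gamma (1 + d / a) / d / t `^ (d / a)).
  rewrite -(damped_Gamma a1 d0 t0) -RintegralZl//.
    apply: eq_Rintegral => x _.
    by rewrite /f cos0 sin0 !mulr0 mulr1 mul0r subr0 add0r mulrC.
  by have := integrable_damped a1 d0 t0 one n1; apply: eq_integrable => // x _ /=; rewrite mulr1.
rewrite -H0 -/(f _ _) -/(H phi).
have fi s : - v < s < v -> mu.-integrable `]0, +oo[ (EFin \o f s).
  move=> /cosv vs; have p0 : 0 < t * cos s by rewrite mulr_gt0// (lt_trans c0).
  apply: (@integrable_damped a d (t * cos s)
    (fun x => cos (t * sin s * x `^ a - d / a * s + k)) 1) => //.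
    by move=> x x0; solve_continuous.
  by move=> x; exact: cos_max.
pose df (s x : R) := a^-1 * (x `^ (d - 1) * expR (- (t * cos s * x `^ a)) *
    ((d - a * (t * cos s) * x `^ a) * sin (t * sin s * x `^ a + (- (d / a * s) + k))
      + a * (t * sin s) * x `^ a * cos (t * sin s * x `^ a + (- (d / a * s) + k)))).
have dfE s x : - v < s < v -> 0 < x -> is_derive s 1 (f ^~ x) (df s x).
  move=> _ x0; rewrite /f; derive_to_eq => //.
  rewrite /df /= addrA.
  set S := sin (_ + k); set C := cos (_ + k); set E := expR _.
  by field; rewrite gt_eqF.
(* Apart from d / a times a sine, the bracket of [df] is t x^a (sin s C - cos s S), at most 2 t x^a
   in absolute value. *)
pose G x := x `^ (d - 1) * expR (- (t * cos v * x `^ a)) * (d / a + 2 * t * x `^ a).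
have p0 : 0 < t * cos v by rewrite mulr_gt0.
have Gi : mu.-integrable `]0, +oo[ (EFin \o G).
  have i1 := integrable_damped a1 d0 p0 one n1.
  have i2 := integrable_damped a1 ad0 p0 one n1.
  have := integrable_lamD mD (integrable_lamZ mD (d / a) i1) (integrable_lamZ mD (2 * t) i2).
  apply: eq_integrable => // x /[!inE]/=; rewrite in_itv/= andbT => x0.
  congr EFin; have -> : d + a - 1 = (d - 1) + a by ring.
  by rewrite (powRD_gt0 (d - 1) a x0) /G; ring.
have G0 x : 0 <= G x.
  rewrite /G !mulr_ge0 ?powR_ge0 ?expR_ge0// addr_ge0 ?mulr_ge0 ?powR_ge0 ?invr_ge0//; exact: ltW.
have dfG s x : - v < s < v -> 0 < x -> `|df s x| <= G x.
  move=> vs x0; rewrite /df /G mulrCA normrM.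
  rewrite ger0_norm ?mulr_ge0 ?powR_ge0 ?expR_ge0//.
  apply: ler_pM; rewrite ?mulr_ge0 ?powR_ge0 ?expR_ge0//.
    rewrite ler_wpM2l ?powR_ge0// ler_expR lerN2 ler_wpM2r ?powR_ge0//.
    by rewrite ler_pM2l// ltW// cosv.
  set S := sin (_ + _); set C := cos (_ + _).
  have -> : a^-1 * ((d - a * (t * cos s) * x `^ a) * S + a * (t * sin s) * x `^ a * C)
    = d / a * S + (t * x `^ a) * (sin s * C - cos s * S).
    by field; rewrite gt_eqF.
  have da0 : 0 < d / a by rewrite divr_gt0.
  have tx0 : 0 <= t * x `^ a by rewrite mulr_ge0 ?powR_ge0// ltW.
  apply: (le_trans (ler_normD _ _)); apply: lerD.
    by rewrite normrM gtr0_norm// ler_piMr ?sin_max// ltW.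
  rewrite normrM (ger0_norm tx0) -mulrA [leRHS]mulrC.
  rewrite ler_wpM2l// (le_trans (ler_normB _ _))//.
  have -> : 2 = 1 + 1 :> R by ring.
  by rewrite !normrM lerD// mulr_ile1 ?normr_ge0 ?sin_max ?cos_max.
have dH s : - v < s < v -> is_derive s 1 H 0.
  move=> vs; have := is_derive_Rintegral vs fi dfE G0 Gi dfG.
  have ps : 0 < t * cos s by rewrite mulr_gt0// (lt_trans c0)// cosv.
  rewrite (_ : \int[mu]_(x in _) df s x = 0)//.
  rewrite /df RintegralZl//; last exact: integrable_damped_ibp.
  by rewrite damped_ibp ?mulr0.
have cH s : - v < s < v -> {for s, continuous H}.
  by move=> /dH; exact: is_derive_continuous.
have inv (s : R) : 0 <= s <= phi -> - v < s < v.
  by move=> /andP[s0 s1]; rewrite (lt_le_trans _ s0) ?oppr_lt0// (le_lt_trans s1).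
apply/eqP; rewrite -subr_eq0; apply/eqP.
have dH' s : s \in `]0, phi[ -> is_derive s 1 H ((fun=> 0) s).
  rewrite in_itv/= => /andP[s0 s1]; apply: dH; apply: inv.
  by rewrite !ltW.
have cH' : {within `[0, phi], continuous H}.
  apply: continuous_in_subspaceT => s; rewrite inE/= in_itv/= => /inv; exact: cH.
by have [_ _ ->] := MVT_segment phi0 dH' cH'; rewrite mul0r.
Qed.

End damped_oscillation.

(** * The inverse Fourier transform of the propagator and its power series *)

Section cosine_series.
Set Implicit Arguments.
Unset Strict Implicit.
Context (R : realType).
Implicit Types (x y : R) (n : nat).

Lemma cos_sin_natmul_pihalf n :
  cos (n%:R * (pi / 2)) = (~~ odd n)%:R * (-1) ^+ n./2 :> R /\
  sin (n%:R * (pi / 2)) = (odd n)%:R * (-1) ^+ n.-1./2 :> R.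
Proof.
elim: n => [|n [IHc IHs]]; first by rewrite !mul0r cos0 sin0 /= !mulr1.
rewrite -natr1 mulrDl mul1r cosDpihalf sinDpihalf IHc IHs; split => //=.
case: n {IHc IHs} => [|n] /=.
  by rewrite !mul0r oppr0.
by rewrite negbK exprS mulrCA mulN1r.
Qed.

(** The n-th derivative of the cosine at y is cos (y + n pi / 2), so this is the Taylor series at y.
    Writing it with one shifted cosine avoids a parity split and fits the phase [k] of
    [damped_cos_Gamma]. *)
Lemma cvg_cosD_series x y :
  \sum_(i < n) (x ^+ i / i`!%:R * cos (y + i%:R * (pi / 2))) @[n --> \oo]
  --> cos (x + y).
Proof.
have hc : series (cos_coeff x) n @[n --> \oo] --> cos x.
  by rewrite unlock; exact: is_cvg_series_cos_coeff.
have hs : series (sin_coeff x) n @[n --> \oo] --> sin x.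
  by rewrite unlock; exact: is_cvg_series_sin_coeff.
rewrite (_ : (fun n => _) = (fun n => cos y * series (cos_coeff x) n -
   sin y * series (sin_coeff x) n)); last first.
  apply/funext => n; rewrite /series/= !big_mkord !mulr_sumr -sumrB.
  apply: eq_bigr => i _; rewrite cosD.
  have [-> ->] := cos_sin_natmul_pihalf i.
  by rewrite cos_coeffE sin_coeffE /=; ring.
rewrite addrC cosD; apply: cvgB; (apply: cvgM; first exact: cvg_cst); by [].
Qed.

Lemma normr_cosD_series_le x y n :
  `|\sum_(i < n) (x ^+ i / i`!%:R * cos (y + i%:R * (pi / 2)))| <= expR `|x|.
Proof.
apply: (@le_trans _ _ (series (exp_coeff `|x|) n)).
  rewrite /series/= big_mkord; apply: (le_trans (ler_norm_sum _ _ _)).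
  apply: ler_sum => i _; rewrite normrM -[leRHS]mulr1 ler_pM ?cos_max//.
  by rewrite normrM normrX normfV normr_nat.
rewrite -[leRHS]/(limn (series (exp_coeff `|x|))).
apply: nondecreasing_cvgn_le.
  apply/nondecreasing_seqP => k; rewrite /series/= big_nat_recr//= lerDl.
  by rewrite divr_ge0// exprn_ge0.
exact: is_cvg_series_exp_coeff.
Qed.

End cosine_series.

(** * Termwise integration of the Taylor expansion *)

Section fundamental_kernel.
Set Implicit Arguments.
Unset Strict Implicit.
Context (R : realType).
Notation mu := (@lebesgue_measure R).
Implicit Types (a p q x y t phi : R).

(* Real form of the inverse Fourier transform of exp(- (p + iq) |gamma|^a). *)
Definition stable_kernel a p q x : R :=
  pi^-1 * \int[mu]_(g in `]0, +oo[) (expR (- (p * g `^ a)) * cos (x * g + q * g `^ a)).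

Let mD : measurable (`]0, +oo[%classic : set (measurableTypeR R)).
Proof. exact: measurable_itv. Qed.

Lemma integrable_expR_powR_bounded a p y (h : R -> R) (M : R) : 1 < a -> 0 < p ->
  (forall g : R, 0 < g -> {for g, continuous h}) ->
  (forall g : R, 0 < g -> `|h g| <= M * expR (y * g)) ->
  mu.-integrable `]0, +oo[ (EFin \o (fun g : R => expR (- (p * g `^ a)) * h g)).
Proof.
move=> a1 p0 ch hM.
apply: (@dominated_integrable_real _ _ R mu _ _ _
  (fun g => M * (g `^ (1 - 1) * expR (y * g - p * g `^ a)))) => //.
- apply: measurable_half_line => g g0; solve_continuous => //; exact: ch.
- by apply: integrable_lamZ => //; exact: integrable_powR_expR_powR.
- move=> g /=; rewrite in_itv/= andbT => g0.
  rewrite subrr powRr0 mul1r expRD mulrA mulrC normrM ler_pM//; last first.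
    by rewrite ger0_norm ?expR_ge0.
  exact: hM.
Qed.

Lemma integrable_stable_kernel a p q x : 1 < a -> 0 < p ->
  mu.-integrable `]0, +oo[
   (EFin \o (fun g : R => expR (- (p * g `^ a)) * cos (x * g + q * g `^ a))).
Proof.
move=> a1 p0; apply: (@integrable_expR_powR_bounded _ _ 0
  (fun g => cos (x * g + q * g `^ a)) 1) => //.
- by move=> g g0; solve_continuous.
- by move=> g g0; rewrite mul0r expR0 mul1r cos_max.
Qed.

Lemma continuous_stable_kernel a p q : 1 < a -> 0 < p ->
  continuous (stable_kernel a p q).
Proof.
move=> a1 p0 x; apply: cvgM; first exact: cvg_cst.
pose f x g := expR (- (p * g `^ a)) * cos (x * g + q * g `^ a).
have xI : x \in (`]x - 1, x + 1[%classic : set R).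
  by rewrite inE/= in_itv/= ltrBlDr !ltrDl ltr01.
have i1 : mu.-integrable `]0, +oo[ (EFin \o (fun g : R => expR (- (p * g `^ a)) * 1)).
  apply: (@integrable_expR_powR_bounded _ _ 0 (fun=> 1) 1) => //.
    by move=> *; exact: cst_continuous.
  by move=> g _; rewrite normr1 mul0r expR0 mul1r.
apply: (@continuity_under_integral R _ _ mu f _ mD (x - 1) (x + 1) _ _ _ i1 _ x xI).
- by move=> y _; exact: integrable_stable_kernel.
- apply/aeW => g _ y _; rewrite /f.
  have : {for y, continuous (fun z : R => expR (- (p * g `^ a)) * cos (z * g + q * g `^ a))}.
    by solve_continuous.
  exact.
- move=> y _; apply/aeW => g _; rewrite /f normrM ger0_norm ?expR_ge0//.
  by rewrite ler_wpM2l ?expR_ge0 ?cos_max.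
Qed.

(** An instance of [damped_cos_Gamma] with d = n + 1, whose phase is chosen to cancel the term - d /
    a * phi there; the division by d turns n! into (n + 1)!. *)
Lemma Rintegral_taylor_term a t phi x n : 1 < a -> 0 < t -> 0 <= phi -> phi < pi / 2 ->
  \int[mu]_(g in `]0, +oo[) (expR (- (t * cos phi * g `^ a)) *
     ((x * g) ^+ n / n`!%:R * cos (t * sin phi * g `^ a + n%:R * (pi / 2)))) =
  x ^+ n / n.+1`!%:R * cos (n.+1%:R / a * phi + n%:R * (pi / 2)) *
    Gamma (1 + n.+1%:R / a) / (t `^ a^-1) ^+ n.+1.
Proof.
move=> a1 t0 phi0 phi1; have a0 : 0 < a by exact: lt_trans a1.
have n0 : 0 < n.+1%:R :> R by [].
have := damped_cos_Gamma (n.+1%:R / a * phi + n%:R * (pi / 2)) a1 n0 t0 phi0 phi1.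
set I := (X in X = _ -> _) => E.
have cp : 0 < cos phi by apply: cos_gt0_pihalf; rewrite phi1 andbT (lt_le_trans _ phi0)// oppr_lt0 divr_gt0 ?pi_gt0.
have -> : (t `^ a^-1) ^+ n.+1 = t `^ (n.+1%:R / a).
  by rewrite -powR_mulrn ?powR_ge0// -powRrM mulrC.
transitivity (x ^+ n / n`!%:R * I).
  rewrite /I -RintegralZl//; last first.
    apply: (@integrable_damped _ _ _ _ (fun g => cos (t * sin phi * g `^ a - n.+1%:R / a * phi
      + (n.+1%:R / a * phi + n%:R * (pi / 2)))) 1) => //.
    - by rewrite mulr_gt0.
    - by move=> g g0; solve_continuous.
    - by move=> g; exact: cos_max.
  apply: eq_Rintegral => g /[!inE]/=; rewrite in_itv/= andbT => g0.
  have -> : g `^ (n.+1%:R - 1) = g ^+ n.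
    by rewrite -powR_mulrn ?(ltW g0)//; congr (_ `^ _); rewrite -natr1 addrK.
  by rewrite addrA subrK exprMn; ring.
rewrite E factS natrM; field.
by rewrite nat1r !pnatr_eq0 -lt0n fact_gt0 gt_eqF ?powR_gt0.
Qed.

(** All partial sums are bounded by e^{|x| g}, integrable against e^{-p g^a} since a > 1.
    Convergence of the series thus comes out of dominated convergence, with no growth estimate on
    Gamma. *)
Lemma cvg_Rintegral_taylor a p q x : 1 < a -> 0 < p ->
  \sum_(i < n) \int[mu]_(g in `]0, +oo[) (expR (- (p * g `^ a)) *
     ((x * g) ^+ i / i`!%:R * cos (q * g `^ a + i%:R * (pi / 2)))) @[n --> \oo] -->
  pi * stable_kernel a p q x.
Proof.
move=> a1 p0; rewrite /stable_kernel mulVKf ?gt_eqF ?pi_gt0//.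
pose S n g := \sum_(i < n) ((x * g) ^+ i / i`!%:R * cos (q * g `^ a + i%:R * (pi / 2))).
have cS n g : 0 < g -> {for g, continuous (S n)}.
  move=> g0; elim: n => [|n IH].
    rewrite (_ : S 0%N = fun=> 0); first exact: cst_continuous.
    by apply/funext => z; rewrite /S big_ord0.
  rewrite (_ : S n.+1 = fun z => S n z +
      ((x * z) ^+ n / n`!%:R * cos (q * z `^ a + n%:R * (pi / 2)))); last first.
    by apply/funext => z; rewrite /S big_ord_recr.
  by solve_continuous => //; rewrite pnatr_eq0 -lt0n fact_gt0.
have bS n g : 0 < g -> `|S n g| <= 1 * expR (`|x| * g).
  move=> g0; rewrite mul1r (le_trans (normr_cosD_series_le _ _ _))//.
  by rewrite normrM (gtr0_norm g0).
have iS n := integrable_expR_powR_bounded a1 p0 (cS n) (bS n).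
have E n : \sum_(i < n) \int[mu]_(g in `]0, +oo[) (expR (- (p * g `^ a)) *
     ((x * g) ^+ i / i`!%:R * cos (q * g `^ a + i%:R * (pi / 2)))) =
   \int[mu]_(g in `]0, +oo[) (expR (- (p * g `^ a)) * S n g).
  elim: n => [|n IH].
    rewrite big_ord0 /S; under eq_Rintegral do rewrite big_ord0 mulr0.
    by rewrite /Rintegral integral0.
  rewrite big_ord_recr/= IH -RintegralD//; last first.
    apply: (integrable_expR_powR_bounded (y := `|x|) (M := 1) a1 p0).
      by move=> g g0; solve_continuous => //; rewrite pnatr_eq0 -lt0n fact_gt0.
    move=> g g0; rewrite mul1r normrM -[leRHS]mulr1 ler_pM ?cos_max//.
    rewrite normrM normrX normfV normr_nat normrM (gtr0_norm g0).
    case: n {IH} => [|n].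
      by rewrite expr0 fact0 divr1 -expR0 ler_expR mulr_ge0// ltW.
    apply: (@le_trans _ _ (1 + (`|x| * g) ^+ n.+1 / n.+1`!%:R)); first by rewrite lerDr.
    by apply: expR_ge1Dxn; rewrite mulr_ge0// ltW.
  by apply: eq_Rintegral => g _; rewrite /S big_ord_recr/= mulrDr.
under eq_fun do rewrite E.
apply: (@cvg_Rintegral_dominated _ _ R mu _ mD _ _ (fun g : R => expR (- (p * g `^ a)) * (1 * expR (`|x| * g))) _ _ _ _).2.
- by move=> n; apply/measurable_EFinP; have := iS n; exact: measurable_int.
- move=> g _; apply: cvgM; first exact: cvg_cst.
  exact: cvg_cosD_series.
- apply: (integrable_expR_powR_bounded (y := `|x|) (M := 1) a1 p0).
    by move=> g g0; solve_continuous.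
  by move=> g g0; rewrite mul1r ger0_norm// expR_ge0.
- move=> n g /=; rewrite in_itv/= andbT => g0.
  rewrite normrM ger0_norm ?expR_ge0// ler_wpM2l ?expR_ge0//; exact: bS.
Qed.

End fundamental_kernel.

(** * Identification of the series with the kernel *)

Section series_solution.
Set Implicit Arguments.
Unset Strict Implicit.
Context (R : realType) (alpha theta : R).
Context (theta_gt0 : 0 < theta) (theta_lt1 : theta < 1)
  (alpha_gt1 : 1 < alpha) (alpha_theta_gt1 : 1 < alpha * theta).
Notation mu := (@lebesgue_measure R).
Notation a := (alpha * theta).
Notation phi := (pi * theta / 2).
Implicit Types (x t : R) (n : nat).

Let phi_ge0 : 0 <= phi.
Proof. by rewrite !mulr_ge0 ?pi_ge0 ?invr_ge0// ltW. Qed.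

Let phi_lt : phi < pi / 2.
Proof. by rewrite ltr_pM2r ?invr_gt0// gtr_pMr ?pi_gt0. Qed.

Lemma cos_phi_gt0 : 0 < cos phi.
Proof.
by apply: cos_gt0_pihalf; rewrite phi_lt andbT (lt_le_trans _ phi_ge0)// oppr_lt0 divr_gt0 ?pi_gt0.
Qed.

Lemma cos_natmulpiD n (y : R) : cos (n%:R * pi + y) = (-1) ^+ n * cos y.
Proof.
elim: n => [|n IH]; first by rewrite mul0r add0r mul1r.
by rewrite -natr1 mulrDl mul1r -addrA (addrC pi) addrA cosDpi IH exprS mulN1r mulNr.
Qed.

Lemma u_termE x t n : 0 < t -> u_term alpha theta x t n.+1 =
  - x * \int[mu]_(g in `]0, +oo[) (expR (- (t * cos phi * g `^ a)) *
     ((x * g) ^+ n / n`!%:R * cos (t * sin phi * g `^ a + n%:R * (pi / 2)))).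
Proof.
move=> t0; rewrite Rintegral_taylor_term// /u_term.
set w := n.+1%:R * pi * ((alpha - 1) / (2 * alpha)).
have al0 : alpha != 0 by rewrite gt_eqF// (lt_trans ltr01).
have th0 : theta != 0 by rewrite gt_eqF.
(* Because phi / a = pi / (2 alpha), theta disappears from the phase. The cosine of w - pi / 2 is
   the sine of the series, and n pi contributes the sign (-1)^n that is absorbed by (- x)^(n +
   1). *)
have -> : n.+1%:R / a * phi + n%:R * (pi / 2) = n%:R * pi + (- (w - pi / 2)).
  by rewrite /w -natr1; field; rewrite al0.
rewrite cos_natmulpiD cosN cosBpihalf (mulrC theta).
rewrite [(- (x / _)) ^+ _]exprNn expr_div_n !exprS.
have tn0 : t `^ a^-1 != 0 by rewrite gt_eqF// powR_gt0.
by field; rewrite expf_neq0 tn0 ?pnatr_eq0 -?lt0n ?fact_gt0.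
Qed.

Lemma cvg_u_term x t : 0 < t ->
  \sum_(1 <= k < n) u_term alpha theta x t k @[n --> \oo] -->
  - x * (pi * stable_kernel a (t * cos phi) (t * sin phi) x).
Proof.
move=> t0; have p0 : 0 < t * cos phi by rewrite mulr_gt0// cos_phi_gt0.
have h := @cvg_Rintegral_taylor R a (t * cos phi) (t * sin phi) x alpha_theta_gt1 p0.
rewrite -(cvg_shiftn 1).
rewrite (_ : (fun n => _) = (fun n => - x * \sum_(i < n) \int[mu]_(g in `]0, +oo[)
   (expR (- (t * cos phi * g `^ a)) *
     ((x * g) ^+ i / i`!%:R * cos (t * sin phi * g `^ a + i%:R * (pi / 2)))))).
  by apply: cvgM; [exact: cvg_cst|exact: h].
apply/funext => n; rewrite addn1 big_add1 big_mkord mulr_sumr.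
by apply: eq_bigr => i _; rewrite u_termE.
Qed.

Lemma u_seriesE x t : x != 0 -> 0 < t ->
  u_series alpha theta x t = stable_kernel a (t * cos phi) (t * sin phi) x.
Proof.
move=> x0 t0; rewrite /u_series (cvg_lim _ (@cvg_u_term x t t0))//.
have pn : (pi : R) != 0 by rewrite gt_eqF ?pi_gt0.
move: pn (stable_kernel _ _ _ _); move: (pi : R) => P Pn K; field; by rewrite Pn x0.
Qed.

(** At x = 0 the solution is a limit over a punctured neighbourhood, on which the series already
    coincides with a function continuous at 0. *)
Lemma u_solE x t : 0 < t ->
  u_sol alpha theta x t = stable_kernel a (t * cos phi) (t * sin phi) x.
Proof.
move=> t0; rewrite /u_sol; case: eqP => [->|/eqP x0]; last exact: u_seriesE.
apply: cvg_lim => //.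
have c0 : {for 0, continuous (stable_kernel a (t * cos phi) (t * sin phi))}.
  by apply: continuous_stable_kernel => //; rewrite mulr_gt0// cos_phi_gt0.
apply: cvg_trans (cvg_trans (cvg_fmap2 (@nbhs_dnbhs R 0)) c0).
apply: near_eq_cvg; near=> y; apply/esym/u_seriesE => //.
by near: y; exact: nbhs_dnbhs_neq.
Unshelve. all: by end_near. Qed.

End series_solution.

(** * Decay of the kernel *)

Section kernel_decay.
Set Implicit Arguments.
Unset Strict Implicit.
Context (R : realType).
Notation mu := (@lebesgue_measure R).
Implicit Types (a p q x y t : R).

Let mD : measurable (`]0, +oo[%classic : set (measurableTypeR R)).
Proof. exact: measurable_itv. Qed.

(** Up to an exact derivative, x^2 times the integrand is [- N], where x survives only inside
    bounded sines and cosines. The majorant [B] is free of x, and its worst power at 0 is g^(a -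
    2). *)
Lemma sqr_stable_kernel_bounded a p q : 1 < a -> 0 < p ->
  exists C, forall x, `|x ^+ 2 * (pi * stable_kernel a p q x)| <= C.
Proof.
move=> a1 p0; have a0 : 0 < a by exact: lt_trans a1.
have a10 : 0 < a - 1 by rewrite subr_gt0.
have d20 : 0 < 2 * a - 1 by lra.
pose c1 := a * (a - 1) * (p + `|q|).
pose c2 := a ^+ 2 * (p ^+ 2 + q ^+ 2 + 2 * (p * `|q|)).
have c10 : 0 <= c1 by rewrite mulr_ge0 ?addr_ge0 ?mulr_ge0 ?(ltW a0) ?(ltW a10) ?(ltW p0).
have c20 : 0 <= c2.
  by rewrite mulr_ge0 ?sqr_ge0// !addr_ge0 ?sqr_ge0// ?mulr_ge0 ?(ltW p0).
pose B g := expR (- (p * g `^ a)) * (c1 * g `^ (a - 1 - 1) + c2 * g `^ (2 * a - 1 - 1)).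
have one (x : R) : 0 < x -> {for x, continuous (fun=> 1 : R)}.
  by move=> _; exact: cst_continuous.
have n1 (x : R) : `|(fun=> 1 : R) x| <= 1 by rewrite normr1.
have iB : mu.-integrable `]0, +oo[ (EFin \o B).
  have i1 := integrable_damped a1 a10 p0 one n1.
  have i2 := integrable_damped a1 d20 p0 one n1.
  have := integrable_lamD mD (integrable_lamZ mD c1 i1) (integrable_lamZ mD c2 i2).
  by apply: eq_integrable => // g _; congr EFin; rewrite /B; ring.
exists (\int[mu]_(g in `]0, +oo[) B g) => x.
rewrite /stable_kernel mulVKf ?gt_eqF ?pi_gt0//.
pose e (g : R) := expR (- (p * g `^ a)).
pose T g := x * g + q * g `^ a.
(* With psi(g) = e^{-(p - iq) g^a}, this is Re (e^{i x g} psi''), and [F] below is Re (e^{i x g}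
   (psi' - i x psi)), so both integrations by parts are done at once. [F] tends to 0 at 0 because
   psi is real there and psi' behaves like g^(a - 1). *)
pose N g := e g * (- (a * (a - 1) * g `^ (a - 1 - 1) * (p * cos (T g) + q * sin (T g))) +
   a ^+ 2 * g `^ (2 * a - 1 - 1) * ((p ^+ 2 - q ^+ 2) * cos (T g) + 2 * (p * q) * sin (T g))).
have e0 g : 0 <= e g by exact: expR_ge0.
have NB g : `|N g| <= B g.
  rewrite /N /B normrM (ger0_norm (e0 g)) ler_wpM2l//.
  apply: (le_trans (ler_normD _ _)); apply: lerD.
    rewrite normrN normrM ger0_norm ?mulr_ge0 ?powR_ge0 ?(ltW a0) ?(ltW a10)//.
    rewrite /c1 [leRHS]mulrAC ler_wpM2l ?mulr_ge0 ?powR_ge0 ?(ltW a0) ?(ltW a10)//.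
    apply: (le_trans (ler_normD _ _)).
    by rewrite !normrM (gtr0_norm p0) lerD// ler_piMr ?cos_max ?sin_max// ltW.
  rewrite normrM ger0_norm ?mulr_ge0 ?powR_ge0 ?sqr_ge0 ?(ltW a0)//.
  rewrite /c2 [leRHS]mulrAC ler_wpM2l ?mulr_ge0 ?powR_ge0 ?sqr_ge0 ?(ltW a0)//.
  apply: (le_trans (ler_normD _ _)); apply: lerD.
    rewrite normrM -[leRHS]mulr1 ler_pM ?cos_max//.
    by rewrite (le_trans (ler_normB _ _))// !ger0_norm ?sqr_ge0.
  rewrite normrM -[leRHS]mulr1 ler_pM ?sin_max//.
  by rewrite !normrM (gtr0_norm p0) ger0_norm.
have cN g : 0 < g -> {for g, continuous N}.
  by move=> g0; rewrite /N /e /T; solve_continuous.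
have iN : mu.-integrable `]0, +oo[ (EFin \o N).
  apply: (@dominated_integrable_real _ _ R mu _ _ _ B) => //.
  exact: measurable_half_line.
have iK := integrable_stable_kernel q x a1 p0.
have Z : \int[mu]_(g in `]0, +oo[) (x ^+ 2 * (e g * cos (T g)) + N g) = 0.
  pose F g := e g * (x * sin (T g)) +
    (- (g `^ (a - 1) * e g)) * (a * (p * cos (T g) + q * sin (T g))).
  rewrite -[RHS](subrr 0); apply: (@Rintegral_half_line_FTC _ _ F).
  - by move=> g g0; rewrite /N /e /T; solve_continuous.
  - move=> g g0; rewrite /F /N /e /T; derive_to_eq => //=.
    have -> : g `^ (2 * a - 1 - 1) = (g `^ (a - 1)) ^+ 2.
      by rewrite expr2 -powRD_gt0//; congr (_ `^ _); ring.
    by ring.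
  - exact: (integrable_lamD mD (integrable_lamZ mD (x ^+ 2) iK) iN).
  - rewrite -[X in _ --> X](addr0 0); apply: cvgD.
      under eq_fun do rewrite mulrC.
      apply: (@cvg0_bounded _ _ _ _ _ _ 1); last first.
        move=> g; rewrite ger0_norm ?expR_ge0// expR_le1 oppr_le0.
        by rewrite mulr_ge0 ?powR_ge0// ltW.
      rewrite -[X in _ --> X](mulr0 x); apply: cvgM; first exact: cvg_cst.
      rewrite -[X in _ --> X]sin0; apply: continuous_cvg; first exact: continuous_sin.
      rewrite /T -[X in _ --> X](addr0 0); apply: cvgD.
        rewrite -[X in _ --> X](mulr0 x); apply: cvgM; first exact: cvg_cst.
        exact: cvg_at_right_filter.
      rewrite -[X in _ --> X](mulr0 q); apply: cvgM; first exact: cvg_cst.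
      exact: powR_cvg0.
    apply: (@cvg0_bounded _ _ _ _ _ _ (a * (p + `|q|))); last first.
      move=> g; rewrite normrM (gtr0_norm a0) ler_pM2l//.
      apply: (le_trans (ler_normD _ _)).
      by rewrite !normrM (gtr0_norm p0) lerD// ler_piMr ?cos_max ?sin_max// ltW.
    rewrite -[X in _ --> X]oppr0; apply: cvgN.
    apply: (@cvg0_bounded _ _ _ _ _ _ 1); first exact: powR_cvg0.
    move=> g; rewrite ger0_norm ?expR_ge0// expR_le1 oppr_le0.
    by rewrite mulr_ge0 ?powR_ge0// ltW.
  - rewrite -[X in _ --> X](addr0 0); apply: cvgD.
      apply: (@cvg0_bounded _ _ _ _ _ _ `|x|).
        apply: cvg_trans (@cvg_powR_expR_powR_pinfty R a p 0 a1 p0).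
        by apply: near_eq_cvg; near=> g; rewrite powRr0 mul1r.
      by move=> g; rewrite normrM ler_piMr// sin_max.
    apply: (@cvg0_bounded _ _ _ _ _ _ (a * (p + `|q|))); last first.
      move=> g; rewrite normrM (gtr0_norm a0) ler_pM2l//.
      apply: (le_trans (ler_normD _ _)).
      by rewrite !normrM (gtr0_norm p0) lerD// ler_piMr ?cos_max ?sin_max// ltW.
    by rewrite -[X in _ --> X]oppr0; apply: cvgN; exact: cvg_powR_expR_powR_pinfty.
have -> : x ^+ 2 * \int[mu]_(g in `]0, +oo[) (e g * cos (T g)) = - \int[mu]_(g in `]0, +oo[) N g.
  move: Z; rewrite RintegralD//; last exact: integrable_lamZ.
  by rewrite RintegralZl// => /eqP; rewrite addr_eq0 => /eqP.
rewrite normrN (le_trans (le_normr_Rintegral _ iN))//.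
by apply: le_Rintegral => //; exact: integrable_norm.
Unshelve. all: by end_near. Qed.

Lemma stable_kernel_le_oneDsqr a p q : 1 < a -> 0 < p ->
  exists C, forall x, `|stable_kernel a p q x| <= C * (oneDsqr x)^-1.
Proof.
move=> a1 p0; have [C HC] := sqr_stable_kernel_bounded q a1 p0.
have one (x : R) : 0 < x -> {for x, continuous (fun=> 1 : R)}.
  by move=> _; exact: cst_continuous.
have ei := @integrable_expR_powR_bounded R a p 0 (fun=> 1) 1 a1 p0 one.
have {}ei : mu.-integrable `]0, +oo[ (EFin \o (fun g : R => expR (- (p * g `^ a)) * 1)).
  by apply: ei => g _; rewrite normr1 mul0r expR0 mul1r.
pose C0 := \int[mu]_(g in `]0, +oo[) (expR (- (p * g `^ a)) * 1).
exists (pi^-1 * (C0 + C)) => x.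
have o0 : 0 < oneDsqr x by rewrite (lt_le_trans ltr01)// oneDsqr_ge1.
have pi0 := pi_gt0 R.
rewrite ler_pdivlMr// ler_pdivlMl// mulrA -(gtr0_norm o0) -(gtr0_norm pi0) -!normrM.
rewrite mulrC /oneDsqr mulrDl mul1r (le_trans (ler_normD _ _))// lerD//.
rewrite /stable_kernel mulVKf ?gt_eqF//.
rewrite (le_trans (le_normr_Rintegral _ (integrable_stable_kernel q x a1 p0)))//.
apply: le_Rintegral => //.
  by apply: integrable_norm => //; exact: integrable_stable_kernel.
move=> g _; rewrite normrM ger0_norm ?expR_ge0//.
by rewrite ler_wpM2l ?expR_ge0 ?cos_max.
Qed.

Lemma integrable_oneDsqrV :
  mu.-integrable setT (EFin \o (fun x : R => (oneDsqr x)^-1)).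
Proof.
have o0 (x : R) : 0 <= (oneDsqr x)^-1.
  by rewrite invr_ge0 (le_trans ler01)// oneDsqr_ge1.
apply/integrableP; split.
  apply/measurable_EFinP; apply: continuous_measurable_fun.
  exact: continuous_oneDsqrV.
under eq_integral do rewrite /= ger0_norm//.
rewrite ge0_symfun_integralT//.
- by rewrite -set_itvcy integral0y_oneDsqr -EFinM ltry.
- exact: continuous_oneDsqrV.
- by move=> x; rewrite /= /oneDsqr sqrrN.
Qed.

Lemma integrable_stable_kernelT a p q : 1 < a -> 0 < p ->
  mu.-integrable setT (EFin \o stable_kernel a p q).
Proof.
move=> a1 p0; have [C HC] := stable_kernel_le_oneDsqr q a1 p0.
apply: (@dominated_integrable_real _ _ R mu _ _ _ (fun x => C * (oneDsqr x)^-1)) => //.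
- by apply: continuous_measurable_fun; exact: continuous_stable_kernel.
- by apply: integrable_lamZ => //; exact: integrable_oneDsqrV.
Qed.

End kernel_decay.

(** * Folding and Fubini on the half-line *)

Section fubini_fold.
Set Implicit Arguments.
Unset Strict Implicit.
Context (R : realType).
Notation mu := (@lebesgue_measure R).

Let mD : measurable (`]0, +oo[%classic : set (measurableTypeR R)).
Proof. exact: measurable_itv. Qed.

Lemma ge0_integral_fold (f : R -> R) : (forall x, 0 <= f x) -> continuous f ->
  (\int[mu]_x (f x)%:E = \int[mu]_(x in `]0%R, +oo[) (f x)%:E
    + \int[mu]_(x in `]0%R, +oo[) (f (- x))%:E)%E.
Proof.
move=> f0 cf.
have mf : measurable_fun [set: R] f by exact: continuous_measurable_fun.
have cNf : continuous (f \o -%R).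
  by move=> x; apply: continuous_comp; [exact: opp_continuous|exact: cf].
have mNf : measurable_fun [set: R] (f \o -%R) by exact: continuous_measurable_fun.
have mpos : measurable [set x : R | 0 <= x] by rewrite -set_itvcy.
rewrite -(setUv [set x : R | 0 <= x]) ge0_integral_setU//=; last 4 first.
- exact: measurableC.
- by apply/measurable_EFinP; rewrite setUv.
- by move=> x _; rewrite lee_fin.
- exact/disj_setPCl.
congr (_ + _)%E.
  rewrite -set_itvcy// integral_itv_obnd_cbnd//.
  by apply/measurable_EFinP; exact: measurable_funTS.
rewrite -set_itvcy// setCitvr.
rewrite integral_itv_bndo_bndc; last exact/measurable_EFinP/measurable_funTS.
rewrite -{1}oppr0 ge0_integration_by_substitutionNy//.
- rewrite integral_itv_obnd_cbnd//.
  by apply/measurable_EFinP; exact: measurable_funTS.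
- exact: continuous_subspaceT.
Qed.

Lemma integrable_fold (f : R -> R) : continuous f ->
  mu.-integrable setT (EFin \o f) ->
  mu.-integrable `]0, +oo[ (EFin \o (fun x => f (- x))).
Proof.
move=> cf fi; apply/integrableP; split.
  apply/measurable_EFinP/measurable_funTS; apply: continuous_measurable_fun.
  by move=> x; apply: continuous_comp; [exact: opp_continuous|exact: cf].
have cnf : continuous (fun x => `|f x|).
  by move=> x; apply: continuous_comp; [exact: cf|exact: norm_continuous].
have := @ge0_integral_fold (fun x => `|f x|) (fun x => normr_ge0 _) cnf.
move/integrableP : fi => [_ fi] E.
apply: le_lt_trans fi.
rewrite [leRHS](_ : _ = \int[mu]_x (`|f x|)%:E)%E// E.
by rewrite leeDr// integral_ge0// => x _; rewrite lee_fin.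
Qed.

(** Folding lets the Abel factor be e^{- e x} on x > 0, smooth with explicit primitives, in place of
    e^{- e |x|} on the line. *)
Lemma Rintegral_fold (f : R -> R) : continuous f ->
  mu.-integrable setT (EFin \o f) ->
  \int[mu]_x f x = \int[mu]_(x in `]0, +oo[) (f x + f (- x)).
Proof.
move=> cf fi.
have ge0 (h : R -> R) : (forall x, 0 <= h x) -> continuous h ->
    mu.-integrable setT (EFin \o h) ->
    \int[mu]_x h x = \int[mu]_(x in `]0, +oo[) h x + \int[mu]_(x in `]0, +oo[) h (- x).
  move=> h0 ch hi; rewrite /Rintegral ge0_integral_fold// fineD//.
    apply: integrable_fin_num => //; exact: integrableS hi.
  by apply: integrable_fin_num => //; exact: integrable_fold.
have hN := integrable_fold cf fi.
have hP : mu.-integrable `]0, +oo[ (EFin \o f) by exact: integrableS fi.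
rewrite RintegralD//.
(* The nonnegative case applies to both f + |f| and |f|; the second identity is then subtracted from
   the first. *)
pose n x := `|f x|.
have cn : continuous n.
  by move=> x; apply: continuous_comp; [exact: cf|exact: norm_continuous].
have ni : mu.-integrable setT (EFin \o n) by exact: integrable_norm.
have nN := integrable_fold cn ni.
have nP : mu.-integrable `]0, +oo[ (EFin \o n) by exact: integrableS ni.
have E1 := ge0 n (fun x => normr_ge0 _) cn ni.
have E2 : \int[mu]_x (f x + n x) = \int[mu]_(x in `]0, +oo[) (f x + n x)
    + \int[mu]_(x in `]0, +oo[) (f (- x) + n (- x)).
  apply: (ge0 (fun x => f x + n x)).
  - by move=> x; have := ler_norm (- f x); rewrite normrN -/(n x) -subr_ge0 opprK addrC.
  - by move=> x; apply: cvgD; [exact: cf|exact: cn].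
  - exact: integrable_lamD.
move: E2; rewrite !RintegralD// E1 => E2.
apply: (@addIr _ (\int[mu]_(x in `]0, +oo[) n x + \int[mu]_(x in `]0, +oo[) n (- x))).
by rewrite E2 addrACA.
Qed.

(** A majorant of product form settles Tonelli's condition: the iterated integral of |f| is at most
    the product of the integrals of [u] and [w]. *)
Lemma Rintegral_half_line_Fubini (f : R -> R -> R) (u w : R -> R) :
  measurable_fun [set: measurableTypeR R * measurableTypeR R]
    (fun z => f z.1 z.2) ->
  mu.-integrable `]0, +oo[ (EFin \o u) -> mu.-integrable `]0, +oo[ (EFin \o w) ->
  (forall x y, 0 < x -> 0 < y -> `|f x y| <= u x * w y) ->
  \int[mu]_(x in `]0, +oo[) \int[mu]_(y in `]0, +oo[) f x y =
  \int[mu]_(y in `]0, +oo[) \int[mu]_(x in `]0, +oo[) f x y.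
Proof.
move=> mf iu iw fuw.
pose D : set (measurableTypeR R) := `]0, +oo[%classic.
have Dpos x : D x -> 0 < x by rewrite /D/= in_itv/= andbT.
have mDD : measurable (D `*` D) by exact: measurableX.
(* Extension by zero off the quadrant brings in Fubini on the whole plane; [FE] and [FE'] peel off
   one indicator at a time, so that the partial integrals are again extensions by zero. *)
pose F (z : measurableTypeR R * measurableTypeR R) : \bar R := (((fun z => f z.1 z.2) \_ (D `*` D)) z)%:E.
have mF : measurable_fun setT F.
  apply/measurable_EFinP; apply/(measurable_restrictT _ mDD).
  exact: measurable_funTS.
have FE x y : F (x, y) = (((f x) \_ D) y * \1_D x)%:E.
  rewrite /F !patchE indicE in_setX/=.
  by case: (x \in D); case: (y \in D); rewrite ?mulr1 ?mulr0.
have FE' x y : F (x, y) = (((f ^~ y) \_ D) x * \1_D y)%:E.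
  rewrite /F !patchE indicE in_setX/=.
  by case: (x \in D); case: (y \in D); rewrite ?mulr1 ?mulr0.
have m1 x : measurable_fun [set: measurableTypeR R] (f x).
  exact: (measurable_fun_pair2 x mf).
have m2 y : measurable_fun [set: measurableTypeR R] (f ^~ y).
  exact: (measurable_fun_pair1 y mf).
have i1 x : D x -> mu.-integrable D (EFin \o f x).
  move=> /Dpos x0; apply: (@dominated_integrable_real _ _ R mu _ mD _ (fun y => u x * w y)).
  - exact: measurable_funTS.
  - exact: integrable_lamZ.
  - by move=> y /Dpos y0; exact: fuw.
have i2 y : D y -> mu.-integrable D (EFin \o f ^~ y).
  move=> /Dpos y0; apply: (@dominated_integrable_real _ _ R mu _ mD _ (fun x => w y * u x)).
  - exact: measurable_funTS.
  - exact: integrable_lamZ.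
  - by move=> x /Dpos x0; rewrite mulrC; exact: fuw.
have ri (h : measurableTypeR R -> R) : mu.-integrable D (EFin \o h) ->
    mu.-integrable setT (EFin \o (h \_ D)).
  by move=> hi; rewrite -restrict_EFin; exact: (integrable_mkcond (EFin \o h) mD).1 hi.
have restr (h : measurableTypeR R -> R) : mu.-integrable D (EFin \o h) ->
    (\int[mu]_y ((h \_ D) y)%:E = (\int[mu]_(y in D) h y)%:E)%E.
  move=> hi; rewrite Rintegral_mkcond /Rintegral fineK//.
  by apply: integrable_fin_num => //; exact: ri.
have I1 x : (\int[mu]_y F (x, y) = (((fun x => \int[mu]_(y in D) f x y) \_ D) x)%:E)%E.
  under eq_integral do rewrite FE.
  rewrite indicE patchE; case: ifPn => xD.
    under eq_integral do rewrite mulr1.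
    by rewrite restr//; apply: i1; exact: set_mem.
  by under eq_integral do rewrite mulr0; rewrite integral0.
have I2 y : (\int[mu]_x F (x, y) = (((fun y => \int[mu]_(x in D) f x y) \_ D) y)%:E)%E.
  under eq_integral do rewrite FE'.
  rewrite indicE patchE; case: ifPn => yD.
    under eq_integral do rewrite mulr1.
    by rewrite (restr (f ^~ y))//; apply: i2; exact: set_mem.
  by under eq_integral do rewrite mulr0; rewrite integral0.
have finF : (\int[mu]_x \int[mu]_y `|F (x, y)| < +oo)%E.
  have bF x y : (`|F (x, y)| <= ((u \_ D) x * (w \_ D) y)%:E)%E.
    rewrite /F abse_EFin lee_fin !patchE in_setX/=.
    case: ifPn; last first.
      by case: (x \in D); case: (y \in D) => //; rewrite ?mulr0 ?mul0r normr0.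
    move=> /andP[/[dup] /set_mem/Dpos x0 xD /[dup] /set_mem/Dpos y0 yD].
    by rewrite xD yD; exact: fuw.
  have mF1 x : measurable_fun setT (fun y => F (x, y)).
    exact: (measurable_fun_pair2 x mF).
  pose W := \int[mu]_(y in D) w y.
  have bI x : (\int[mu]_y `|F (x, y)| <= (W * (u \_ D) x)%:E)%E.
    rewrite mulrC EFinM -restr// -integralZl//; last exact: ri.
    apply: ge0_le_integral => //.
    - by apply: measurableT_comp => //; exact: mF1.
    - apply: (@measurable_int _ _ _ mu); apply: integrableZl => //; exact: ri.
  have iWu : mu.-integrable setT (EFin \o (fun x => W * (u \_ D) x)).
    by apply: integrable_lamZ => //; exact: ri.
  have lt1 := integrable_lty (@measurableT _ (measurableTypeR R)) iWu.
  apply: le_lt_trans lt1.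
    apply: ge0_le_integral => //.
    - by move=> x _; exact: integral_ge0.
    - apply: (measurable_fun_fubini_tonelli_F (abse \o F)) => //.
      exact: measurableT_comp.
      by move=> z; exact: abse_ge0.
    - by apply: (@measurable_int _ _ _ mu); exact: iWu.
have iF := (@integrable12ltyP _ _ _ _ R mu mu F mF).2 finF.
have := Fubini iF.
under eq_integral do rewrite I1.
under [X in _ = X -> _]eq_integral do rewrite I2.
by move=> E; rewrite [LHS]Rintegral_mkcond [RHS]Rintegral_mkcond; exact: (congr1 fine E).
Qed.

End fubini_fold.

(** * The Poisson kernel *)

Section poisson_kernel.
Set Implicit Arguments.
Unset Strict Implicit.
Context (R : realType).
Notation mu := (@lebesgue_measure R).
Implicit Types (a p q x y z e : R).

Let mD : measurable (`]0, +oo[%classic : set (measurableTypeR R)).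
Proof. exact: measurable_itv. Qed.

(** Not normalised: its mass pi cancels the factor pi^-1 of [stable_kernel]. *)
Definition poisson_kernel e y := e / (e ^+ 2 + y ^+ 2).

Lemma poisson_den_gt0 e y : 0 < e -> 0 < e ^+ 2 + y ^+ 2.
Proof. by move=> e0; rewrite ltr_pwDl ?sqr_ge0// exprn_gt0. Qed.

Lemma poisson_kernel_ge0 e y : 0 < e -> 0 <= poisson_kernel e y.
Proof. by move=> e0; rewrite divr_ge0 ?ltW// poisson_den_gt0. Qed.

Lemma integrable_expRN e : 0 < e ->
  mu.-integrable `]0, +oo[ (EFin \o (fun x : R => expR (- (e * x)))).
Proof.
move=> e0; have := integrable_powR_expRN (@ltr01 R) e0.
by apply: eq_integrable => // x _; rewrite /= subrr powRr0 mul1r.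
Qed.

Lemma integrable_expRN_cos e y : 0 < e ->
  mu.-integrable `]0, +oo[ (EFin \o (fun x : R => expR (- (e * x)) * cos (y * x))).
Proof.
move=> e0; apply: (@dominated_integrable_real _ _ R mu _ _ _ (fun x => expR (- (e * x)))) => //.
- by apply: measurable_half_line => x x0; solve_continuous.
- exact: integrable_expRN.
- by move=> x _; rewrite normrM ger0_norm ?expR_ge0// ler_piMr ?expR_ge0 ?cos_max.
Qed.

Lemma cvg_expRN e : 0 < e -> expR (- (e * x)) @[x --> +oo] --> (0 : R).
Proof.
move=> e0; apply: (@cvg_comp _ _ _ (fun x => e * x) (fun x => expR (- x)) _ _ _ _ (@cvgr_expR R)).
by apply: gt0_cvgMry => //; exact: cvg_id.
Qed.

Lemma Rintegral_expRN_cos e y : 0 < e ->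
  \int[mu]_(x in `]0, +oo[) (expR (- (e * x)) * cos (y * x)) = poisson_kernel e y.
Proof.
move=> e0; have d0 := poisson_den_gt0 y e0.
pose F x := expR (- (e * x)) * ((y * sin (y * x) - e * cos (y * x)) / (e ^+ 2 + y ^+ 2)).
have cF x : {for x, continuous F}.
  by rewrite /F; solve_continuous.
rewrite (_ : poisson_kernel e y = 0 - F 0); last first.
  rewrite /F !mulr0 oppr0 expR0 sin0 cos0 /poisson_kernel.
  by field; rewrite gt_eqF.
apply: (@Rintegral_half_line_FTC _ _ F).
- by move=> x x0; solve_continuous.
- move=> x x0; rewrite /F; derive_to_eq => /=.
  by field; rewrite gt_eqF.
- exact: integrable_expRN_cos.
- by apply: cvg_at_right_filter; exact: cF.
- apply: (@cvg0_bounded _ _ _ _ _ _ ((`|y| + e) / (e ^+ 2 + y ^+ 2))).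
    exact: cvg_expRN.
  move=> x; rewrite normrM normfV (gtr0_norm d0) ler_pM2r ?invr_gt0//.
  rewrite (le_trans (ler_normB _ _))// !normrM (gtr0_norm e0) lerD//.
    by rewrite ler_piMr// sin_max.
  by rewrite ler_piMr ?cos_max// ltW.
Qed.

(** The total mass, folded about 0 rather than about the centre z. The primitive is a difference of
    two arctangents that cancel at x = 0 for every z and add up to pi / 2 + pi / 2 at infinity. *)
Lemma poisson_sum_FTC e z : 0 < e ->
  let f x := poisson_kernel e (z + x) + poisson_kernel e (z - x) in
  mu.-integrable `]0, +oo[ (EFin \o f) /\ \int[mu]_(x in `]0, +oo[) f x = pi.
Proof.
move=> e0 f; have en0 : e != 0 by rewrite gt_eqF.
pose F x := atan ((z + x) / e) + - atan ((z - x) / e).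
have cf x : {for x, continuous f}.
  rewrite /f /poisson_kernel; solve_continuous; by rewrite gt_eqF// poisson_den_gt0.
have f0 x : 0 <= f x by rewrite addr_ge0// poisson_kernel_ge0.
have dF x : is_derive x 1 F (f x).
  rewrite /F; derive_to_eq => //=.
  have d1 := poisson_den_gt0 (z + x) e0; have d2 := poisson_den_gt0 (z - x) e0.
  rewrite /f /poisson_kernel; field.
  by rewrite en0 !gt_eqF.
have F_le x : `|F x| <= pi.
  have h (y : R) : `|atan y| <= pi / 2.
    by rewrite ler_norml !ltW ?atan_gtNpi2 ?atan_ltpi2.
  by rewrite (le_trans (ler_normB _ _))// (splitr pi) lerD.
have fi : mu.-integrable `]0, +oo[ (EFin \o f).
  exact: (@integrable_half_line_ge0 _ _ F pi).
split => //; rewrite -[RHS]subr0; apply: (@Rintegral_half_line_FTC _ _ F) => //.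
- have F0 : F 0 = 0 by rewrite /F addr0 subr0 subrr.
  rewrite -[X in _ --> X]F0; apply: cvg_at_right_filter; exact: (is_derive_continuous (dF 0)).
- rewrite [X in _ --> X](splitr pi); apply: cvgD.
    apply: (@cvg_comp _ _ _ (fun x => (z + x) / e) atan _ _ _ _ (@cvgy_atan R)).
    apply: gt0_cvgMly; first by rewrite invr_gt0.
    exact: cvg_addrl.
  have h : - ((z - x) / e) @[x --> +oo] --> +oo.
    under eq_fun do rewrite -mulNr opprB.
    by apply: gt0_cvgMly; [rewrite invr_gt0|exact: cvg_addrr].
  under eq_fun do rewrite -atanN.
  exact: (@cvg_comp _ _ _ (fun x => - ((z - x) / e)) atan _ _ _ h (@cvgy_atan R)).
Qed.

(** The kernels themselves have no common integrable majorant: their supremum over e is 1 / (2 |u|)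
    near 0. The factor |v| <= C |u| removes this singularity through 2 e |u| <= e^2 + u^2, which
    gives the C; for |u| > 1 the bounds |v| <= 2 and e <= 1 give the 4. *)
Lemma poisson_kernel_Lipschitz_bound e u v C : 0 < e <= 1 -> 0 <= C ->
  `|v| <= C * `|u| -> `|v| <= 2 -> `|poisson_kernel e u * v| <= (C + 4) * poisson_kernel 1 u.
Proof.
move=> /andP[e0 e1] C0 vC v2; have d0 := poisson_den_gt0 u e0.
have d1 := poisson_den_gt0 u (@ltr01 R).
rewrite normrM ger0_norm ?poisson_kernel_ge0//.
rewrite /poisson_kernel mulrAC ler_pdivrMr// mul1r mulrAC ler_pdivlMr// expr1n.
have u2 : `|u| ^+ 2 = u ^+ 2 by rewrite real_normK ?num_real.
rewrite -u2; set w := `|u| in vC u2 *; set r := `|v| in vC v2 *.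
have w0 : 0 <= w by exact: normr_ge0.
have r0 : 0 <= r by exact: normr_ge0.
have [w1|w1] := leP w 1.
  apply: (@le_trans _ _ (e * (C * w) * 2)).
    by rewrite ler_pM ?mulr_ge0 ?addr_ge0 ?sqr_ge0 ?(ltW e0)// ?ler_pM2l// (_ : 2 = 1 + 1 :> R)// lerD2l expr_le1.
  rewrite -subr_ge0 (_ : _ - _ = C * (e - w) ^+ 2 + 4 * (e ^+ 2 + w ^+ 2)); last by ring.
  by apply: addr_ge0; apply: mulr_ge0; rewrite ?sqr_ge0// ?addr_ge0 ?sqr_ge0.
have w2 : 1 <= w ^+ 2 by rewrite expr_ge1// ltW.
apply: (@le_trans _ _ (1 * 2 * (w ^+ 2 + w ^+ 2))).
  by rewrite !ler_pM ?mulr_ge0 ?addr_ge0 ?sqr_ge0 ?(ltW e0)// lerD2r.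
rewrite -subr_ge0 (_ : _ - _ = C * (e ^+ 2 + w ^+ 2) + 4 * e ^+ 2); last by ring.
by apply: addr_ge0; apply: mulr_ge0; rewrite ?sqr_ge0// ?addr_ge0 ?sqr_ge0.
Qed.

End poisson_kernel.

(** * Regularity of the propagator *)

Section symbol_regularity.
Set Implicit Arguments.
Unset Strict Implicit.
Context (R : realType).
Implicit Types (a p q x y z : R).

Lemma cos_Lipschitz x y : `|cos x - cos y| <= `|x - y|.
Proof.
wlog xy : x y / y <= x.
  move=> H; have [xy|/ltW xy] := leP y x; first exact: H.
  by rewrite distrC [leRHS]distrC; exact: H.
have cc : {within `[y, x], continuous (@cos R)}.
  by apply: continuous_subspaceT; exact: continuous_cos.
have [c _ ->] := MVT_segment xy (fun z _ => is_derive_cos z) cc.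
by rewrite normrM normrN ler_piMl// sin_max.
Qed.

Lemma expRN_Lipschitz x y : 0 <= x -> 0 <= y ->
  `|expR (- x) - expR (- y)| <= `|x - y|.
Proof.
move=> x0 y0; wlog xy : x y x0 y0 / x <= y.
  move=> H; have [xy|/ltW xy] := leP x y; first exact: H.
  by rewrite distrC [leRHS]distrC; exact: H.
rewrite distrC [leRHS]distrC (ger0_norm (_ : 0 <= y - x)) ?subr_ge0//.
rewrite distrC ger0_norm ?subr_ge0 ?ler_expR ?lerN2//.
have -> : expR (- y) = expR (- x) * expR (- (y - x)).
  by rewrite -expRD; congr expR; ring.
rewrite -[X in X - _]mulr1 -mulrBr.
have h : 1 - expR (- (y - x)) <= y - x by have := expR_ge1Dx (- (y - x)); lra.
have h0 : 0 <= 1 - expR (- (y - x)) by rewrite subr_ge0 expR_le1 oppr_le0 subr_ge0.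
by rewrite (le_trans _ h)// ler_piMl// expR_le1 oppr_le0.
Qed.

Definition signed_powR a y := Num.sg y * `|y| `^ a.

Lemma signed_powRN a y : signed_powR a (- y) = - signed_powR a y.
Proof. by rewrite /signed_powR sgrN normrN mulNr. Qed.

Lemma signed_powR_gt0E a y : 0 < y -> signed_powR a y = y `^ a.
Proof. by move=> y0; rewrite /signed_powR gtr0_sg// mul1r gtr0_norm. Qed.

Lemma normr_signed_powR a y : 0 < a -> `|signed_powR a y| = `|y| `^ a.
Proof.
move=> a0; rewrite /signed_powR normrM (ger0_norm (powR_ge0 _ _)) normr_sg.
by case: eqP => [->|_]; rewrite ?mul1r// normr0 powR0 ?mulr0// gt_eqF.
Qed.

Lemma powR_le_linear a L y : 1 < a -> 0 <= y -> y <= L -> y `^ a <= L `^ (a - 1) * y.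
Proof.
move=> a1 y0 yL; rewrite -(mulr_powRB1 y0 (lt_trans ltr01 a1)) mulrC ler_wpM2r//.
by apply: ge0_ler_powR; rewrite ?nnegrE ?(le_trans y0 yL) ?subr_ge0 ?(ltW a1).
Qed.

Lemma powR_Lipschitz a L y z : 1 < a -> 0 < z -> z <= y -> y <= L ->
  y `^ a - z `^ a <= a * L `^ (a - 1) * (y - z).
Proof.
move=> a1 z0 zy yL; have a0 : 0 < a by exact: lt_trans a1.
have dp x : x \in `]z, y[ -> is_derive x 1 (fun x => x `^ a) (a * x `^ (a - 1)).
  by rewrite in_itv/= => /andP[zx _]; apply: is_derive1_powR; exact: lt_trans zx.
have cp : {within `[z, y], continuous (fun x => x `^ a)}.
  apply: continuous_in_subspaceT => x; rewrite inE/= in_itv/= => /andP[zx _].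
  have x0 : 0 < x by exact: lt_le_trans zx.
  exact: (is_derive_continuous (is_derive1_powR a x0)).
have [c + ->] := MVT_segment zy dp cp; rewrite in_itv/= => /andP[zc cy].
rewrite ler_wpM2r ?subr_ge0// ler_pM2l//.
have c0 : 0 < c by exact: lt_le_trans zc.
have cL := le_trans cy yL.
by apply: ge0_ler_powR; rewrite ?nnegrE ?(le_trans (ltW c0) cL) ?subr_ge0 ?(ltW a1) ?(ltW c0).
Qed.

Lemma signed_powR_Lipschitz a L y z : 1 < a -> `|y| <= L -> `|z| <= L ->
  `|signed_powR a y - signed_powR a z| <= a * L `^ (a - 1) * `|y - z|.
Proof.
move=> a1 yL zL; have a0 : 0 < a by exact: lt_trans a1.
have la : L `^ (a - 1) <= a * L `^ (a - 1) by rewrite ler_peMl ?powR_ge0// ltW.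
wlog zy : y z yL zL / z <= y.
  move=> H; have [zy|/ltW yz] := leP z y; first exact: H.
  by rewrite distrC [X in _ <= _ * X]distrC; exact: H.
rewrite (ger0_norm (_ : 0 <= y - z)) ?subr_ge0//.
have [z0|z0] := ltP 0 z.
  have y0 : 0 < y by exact: lt_le_trans zy.
  rewrite !signed_powR_gt0E// ger0_norm; last first.
    by rewrite subr_ge0; apply: ge0_ler_powR; rewrite ?nnegrE ?(ltW a0) ?(ltW y0) ?(ltW z0).
  by apply: powR_Lipschitz => //; rewrite -(gtr0_norm y0).
have [y0|y0] := ltP y 0.
  have z0' : z < 0 by exact: le_lt_trans y0.
  have E x : x < 0 -> signed_powR a x = - (- x) `^ a.
    by move=> x0; rewrite -{1}(opprK x) signed_powRN signed_powR_gt0E ?oppr_gt0.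
  rewrite !E// opprK addrC ger0_norm; last first.
    by rewrite subr_ge0; apply: ge0_ler_powR; rewrite ?nnegrE ?oppr_ge0 ?lerN2 ?(ltW a0) ?(ltW y0) ?(ltW z0').
  rewrite (_ : y - z = - z - - y); last by ring.
  apply: powR_Lipschitz => //; rewrite ?oppr_gt0 ?lerN2//.
  by rewrite -(ltr0_norm z0').
(* Here z <= 0 <= y, so |y - z| = |y| + |z| and each power is bounded separately; the mean value
   theorem is never applied across 0. *)
rewrite (le_trans (ler_normB _ _))// !normr_signed_powR//.
rewrite (_ : y - z = `|y| + `|z|); last by rewrite ger0_norm// ler0_norm.
rewrite mulrDr lerD//.
  by rewrite (le_trans (powR_le_linear a1 (normr_ge0 _) yL))// ler_wpM2r.
by rewrite (le_trans (powR_le_linear a1 (normr_ge0 _) zL))// ler_wpM2r.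
Qed.

(* Re (e^{i k} exp (- p |y|^a - i q sgn(y) |y|^a)) *)
Definition damped_wave a p q k y :=
  expR (- (p * `|y| `^ a)) * cos (k - q * signed_powR a y).

Lemma damped_wave_gt0E a p q k y : 0 < y ->
  damped_wave a p q k y = expR (- (p * y `^ a)) * cos (k - q * y `^ a).
Proof. by move=> y0; rewrite /damped_wave signed_powR_gt0E// gtr0_norm. Qed.

Lemma damped_waveN_gt0E a p q k y : 0 < y ->
  damped_wave a p q k (- y) = expR (- (p * y `^ a)) * cos (k + q * y `^ a).
Proof.
move=> y0; rewrite /damped_wave normrN signed_powRN signed_powR_gt0E//.
by rewrite gtr0_norm// mulrN opprK.
Qed.

Lemma damped_wave_le1 a p q k y : 0 < p -> `|damped_wave a p q k y| <= 1.
Proof.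
move=> p0; rewrite normrM mulr_ile1 ?cos_max// ger0_norm ?expR_ge0//.
by rewrite expR_le1 oppr_le0 mulr_ge0 ?powR_ge0// ltW.
Qed.

(** The point z is fixed but y is arbitrary. The power is only locally Lipschitz, so it is used for
    |y - z| <= 1; farther away the trivial bound 2 takes over, which accounts for the + 2 in the
    constant. *)
Lemma damped_wave_Lipschitz a p q k z : 1 < a -> 0 < p ->
  exists2 C, 0 <= C & forall y,
  `|damped_wave a p q k y - damped_wave a p q k z| <= C * `|y - z|.
Proof.
move=> a1 p0; have a0 : 0 < a by exact: lt_trans a1.
pose C1 := (p + `|q|) * (a * (`|z| + 1) `^ (a - 1)).
have C10 : 0 <= C1 by rewrite mulr_ge0 ?addr_ge0 ?mulr_ge0 ?powR_ge0 ?(ltW a0) ?(ltW p0).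
exists (C1 + 2); first by rewrite addr_ge0.
move=> y; have [yz|yz] := leP `|y - z| 1; last first.
  rewrite (@le_trans _ _ 2)//.
    by rewrite (le_trans (ler_normB _ _))// -[2]/(1 + 1) lerD// damped_wave_le1.
  by rewrite (@le_trans _ _ (2 * `|y - z|)) ?ler_peMr ?(ltW yz)// ler_wpM2r ?lerDr.
have yL : `|y| <= `|z| + 1.
  by rewrite -(subrK z y) (le_trans (ler_normD _ _))// addrC lerD2l.
have zL : `|z| <= `|z| + 1 by rewrite lerDl.
have S := signed_powR_Lipschitz a1 yL zL.
apply: (@le_trans _ _ (C1 * `|y - z|)); last by rewrite ler_wpM2r// lerDl.
rewrite /C1 -mulrA; apply: (@le_trans _ _ ((p + `|q|) * `|signed_powR a y - signed_powR a z|)); last first.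
  by rewrite ler_wpM2l ?addr_ge0 ?(ltW p0).
rewrite /damped_wave.
set E := expR _; set F := cos _; set E' := expR _; set F' := cos _.
rewrite (_ : _ - _ = (E - E') * F + E' * (F - F')); last by ring.
rewrite (le_trans (ler_normD _ _))// [leRHS]mulrDl lerD//.
  rewrite normrM (@le_trans _ _ `|E - E'|) ?ler_piMr ?cos_max//.
  rewrite (le_trans (expRN_Lipschitz _ _))// ?mulr_ge0 ?powR_ge0 ?(ltW p0)//.
  rewrite -mulrBr normrM (gtr0_norm p0) ler_pM2l//.
  by rewrite -!normr_signed_powR// ler_dist_dist.
rewrite normrM (@le_trans _ _ `|F - F'|)//.
  rewrite ler_piMl// ger0_norm ?expR_ge0// expR_le1 oppr_le0.
  by rewrite mulr_ge0 ?powR_ge0// ltW.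
rewrite (le_trans (cos_Lipschitz _ _))//.
rewrite (_ : k - q * signed_powR a y - (k - q * signed_powR a z) = - (q * (signed_powR a y - signed_powR a z))); last by ring.
by rewrite normrN normrM.
Qed.

End symbol_regularity.

(** * Fourier inversion *)

Section fourier_inversion.
Set Implicit Arguments.
Unset Strict Implicit.
Context (R : realType).
Notation mu := (@lebesgue_measure R).
Implicit Types (a p q x y z e k : R).

Let mD : measurable (`]0, +oo[%classic : set (measurableTypeR R)).
Proof. exact: measurable_itv. Qed.

Let eps n : R := n.+1%:R^-1.

Let eps_gt0 n : 0 < eps n. Proof. by rewrite invr_gt0. Qed.

Let eps_le1 n : eps n <= 1. Proof. by rewrite invf_le1// ler1n. Qed.

Lemma cvg_poisson_kernel0 y : y != 0 ->
  poisson_kernel (eps n) y @[n --> \oo] --> 0.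
Proof.
move=> y0; rewrite (_ : 0 = 0 / (0 ^+ 2 + y ^+ 2)); last by rewrite mul0r.
have c : eps n @[n --> \oo] --> 0 by exact: cvg_invSn.
apply: cvgM; first exact: c.
apply: cvgV; first by rewrite expr0n add0r sqrf_eq0.
apply: cvgD; last exact: cvg_cst.
by rewrite expr2; apply: cvgM; exact: c.
Qed.

(** Approximate identity: the mass pi times [G z] is split off, and the Lipschitz condition at z
    yields a majorant of the remainder [h n] independent of n, with no splitting near z. *)
Lemma cvg_poisson_integral (G : R -> R) z C :
  (forall x, 0 < x -> {for x, continuous G}) ->
  (forall x, 0 < x -> {for x, continuous (fun x => G (- x))}) ->
  (forall y, `|G y| <= 1) -> 0 <= C ->
  (forall y, `|G y - G z| <= C * `|y - z|) ->
  \int[mu]_(x in `]0, +oo[) (poisson_kernel (eps n) (z + x) * G (- x) +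
     poisson_kernel (eps n) (z - x) * G x) @[n --> \oo] --> pi * G z.
Proof.
move=> cG cGN G1 C0 GC.
pose h n x := poisson_kernel (eps n) (z + x) * (G (- x) - G z) +
     poisson_kernel (eps n) (z - x) * (G x - G z).
have G2 y : `|G y - G z| <= 2.
  by rewrite (le_trans (ler_normB _ _))// -[2]/(1 + 1) lerD.
have v1 x : `|G (- x) - G z| <= C * `|z + x|.
  by rewrite (le_trans (GC _))// -opprD normrN addrC.
have v2 x : `|G x - G z| <= C * `|z - x| by rewrite (le_trans (GC _))// distrC.
have mh n : measurable_fun (`]0, +oo[%classic : set (measurableTypeR R)) (h n).
  apply: measurable_half_line => x x0; rewrite /h /poisson_kernel.
  solve_continuous; rewrite ?gt_eqF ?poisson_den_gt0//; [exact: cGN|exact: cG].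
have P1 := @poisson_sum_FTC R 1 z ltr01.
have hb n x : `|h n x| <= (C + 4) * (poisson_kernel 1 (z + x) + poisson_kernel 1 (z - x)).
  rewrite mulrDr (le_trans (ler_normD _ _))// lerD//;
  by apply: poisson_kernel_Lipschitz_bound; rewrite ?eps_gt0 ?eps_le1.
have ig := integrable_lamZ mD (C + 4) P1.1.
(* At u = 0 the kernel is 1 / eps n and blows up, but v vanishes there. *)
have P0 (u v : R) : `|v| <= C * `|u| -> poisson_kernel (eps n) u * v @[n --> \oo] --> 0.
  have [-> |u0 _] := eqVneq u 0.
    rewrite normr0 mulr0 normr_le0 => /eqP ->.
    by under eq_fun do rewrite mulr0; exact: cvg_cst.
  rewrite -[X in _ --> X](mul0r v); apply: cvgM; last exact: cvg_cst.
  exact: cvg_poisson_kernel0.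
have [_ hc] := @cvg_Rintegral_dominated _ _ R mu _ mD h (fun=> 0)
  (fun x => (C + 4) * (poisson_kernel 1 (z + x) + poisson_kernel 1 (z - x)))
  mh (fun x _ => ltac:(by rewrite -(addr0 0); apply: cvgD; apply: P0)) ig (fun n x _ => hb n x).
have E n : \int[mu]_(x in `]0, +oo[) (poisson_kernel (eps n) (z + x) * G (- x) +
     poisson_kernel (eps n) (z - x) * G x) = \int[mu]_(x in `]0, +oo[) h n x + pi * G z.
  have [fi <-] := @poisson_sum_FTC R (eps n) z (eps_gt0 n).
  rewrite mulrC -RintegralZl// -RintegralD//.
  - by apply: eq_Rintegral => x _; rewrite /h; ring.
  - exact: (@dominated_integrable_real _ _ R mu _ mD _ _ (mh n) ig (fun x _ => hb n x)).
  - exact: integrable_lamZ.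
rewrite (_ : (fun n => _) = (fun n => \int[mu]_(x in `]0, +oo[) h n x + pi * G z)); last exact/funext.
rewrite -[X in _ --> X]add0r; apply: cvgD; last exact: cvg_cst.
by move: hc; rewrite /Rintegral integral0.
Qed.

(** With u = z x and v = x y, adding the contributions of x and - x cancels the terms odd in x and
    separates x from the phases; the integrals left in x are Laplace transforms of cosines of
    frequencies z + y and z - y. *)
Lemma cos_fold (u v b k : R) :
  cos (u + k) * cos (v + b) + cos (- u + k) * cos (- v + b) =
  cos (u + v) * cos (k + b) + cos (u - v) * cos (k - b).
Proof. by rewrite !(cosD, cosB, cosN, sinN); ring. Qed.

Lemma measurable_kernel_integrand a p q z k e :
  measurable_fun [set: measurableTypeR R * measurableTypeR R]
   (fun w => expR (- (e * w.1)) * expR (- (p * w.2 `^ a)) *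
     (cos (z * w.1 + k) * cos (w.1 * w.2 + q * w.2 `^ a) +
      cos (- (z * w.1) + k) * cos (- (w.1 * w.2) + q * w.2 `^ a))).
Proof.
have comp (h : R -> R) (g : measurableTypeR R * measurableTypeR R -> R) :
    measurable_fun [set: R] h -> measurable_fun setT g ->
    measurable_fun [set: measurableTypeR R * measurableTypeR R] (fun w => h (g w)).
  by move=> mh mg; exact: (measurableT_comp mh mg).
have mcos : measurable_fun [set: R] (@cos R).
  by apply: continuous_measurable_fun; exact: continuous_cos.
have m1 : measurable_fun [set: measurableTypeR R * measurableTypeR R] (fun w => w.1 : R).
  exact: measurable_fst.
have m2 : measurable_fun [set: measurableTypeR R * measurableTypeR R] (fun w => w.2 : R).
  exact: measurable_snd.
have m2a := comp _ _ (measurable_powR a) m2.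
have mc (c : R) : measurable_fun [set: measurableTypeR R * measurableTypeR R] (fun=> c).
  exact: measurable_cst.
have mz1 c := measurable_funM (mc c) m1.
have mc2 c := measurable_funM (mc c) m2a.
have m12 := measurable_funM m1 m2.
have e1 := comp _ _ (@measurable_expR R) (measurable_funN (mz1 e)).
have e2 := comp _ _ (@measurable_expR R) (measurable_funN (mc2 p)).
have c1 := comp _ _ mcos (measurable_funD (mz1 z) (mc k)).
have c2 := comp _ _ mcos (measurable_funD m12 (mc2 q)).
have c3 := comp _ _ mcos (measurable_funD (measurable_funN (mz1 z)) (mc k)).
have c4 := comp _ _ mcos (measurable_funD (measurable_funN m12) (mc2 q)).
exact: (measurable_funM (measurable_funM e1 e2)
  (measurable_funD (measurable_funM c1 c2) (measurable_funM c3 c4))).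
Qed.

Lemma continuous_damped_wave a p q k : 1 < a -> 0 < p ->
  continuous (damped_wave a p q k).
Proof.
move=> a1 p0 x; have [C C0 HC] := damped_wave_Lipschitz q k x a1 p0.
have C1 : 0 < C + 1 by rewrite ltr_wpDl.
apply/cvgrPdist_le => e e0; near=> y.
have yx : `|x - y| <= e / (C + 1).
  by near: y; apply: cvgr_dist_le; [exact: cvg_id|rewrite divr_gt0].
rewrite distrC (le_trans (HC y))// distrC (@le_trans _ _ ((C + 1) * `|x - y|))//.
  by rewrite ler_wpM2r// lerDl.
by rewrite -ler_pdivlMl// mulrC.
Unshelve. all: by end_near. Qed.

Lemma continuous_cos_kernel a p q z k : 1 < a -> 0 < p ->
  continuous (fun x => cos (z * x + k) * stable_kernel a p q x).
Proof.
move=> a1 p0 x; have cK : {for x, continuous (stable_kernel a p q)}.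
  exact: continuous_stable_kernel.
have c : {for x, continuous (fun x => cos (z * x + k))} by solve_continuous.
exact: (continuous_lamM c cK).
Qed.

Lemma integrable_cos_kernel a p q z k : 1 < a -> 0 < p ->
  mu.-integrable setT (EFin \o (fun x => cos (z * x + k) * stable_kernel a p q x)).
Proof.
move=> a1 p0; have iK := integrable_stable_kernelT q a1 p0.
apply: (@dominated_integrable_real _ _ R mu _ _ _ (fun x => `|stable_kernel a p q x|)) => //.
- by apply: continuous_measurable_fun; exact: continuous_cos_kernel.
- exact: integrable_norm.
- by move=> x _; rewrite normrM ler_piMl ?cos_max.
Qed.

Lemma continuous_fold (f : R -> R) : continuous f -> continuous (fun x => f x + f (- x)).
Proof.
move=> cf x; have cN : {for x, continuous (fun x => f (- x))}.
  by apply: continuous_lam_comp; [exact: opp_continuous|exact: cf].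
by apply: continuous_lamD; [exact: cf|exact: cN].
Qed.

Lemma integrable_lam_fold (f : R -> R) : continuous f ->
  mu.-integrable setT (EFin \o f) ->
  mu.-integrable `]0, +oo[ (EFin \o (fun x => f x + f (- x))).
Proof.
move=> cf fi; apply: integrable_lamD => //; last exact: integrable_fold.
exact: integrableS fi.
Qed.

Lemma measurable_expRN_M e (f : R -> R) : continuous f ->
  measurable_fun (`]0, +oo[%classic : set R) (fun x => expR (- (e * x)) * f x).
Proof.
move=> cf; apply: measurable_half_line => x _.
have c : {for x, continuous (fun x => expR (- (e * x)))} by solve_continuous.
exact: (continuous_lamM c (cf x)).
Qed.

Lemma normr_expRN_M e (f : R -> R) x : 0 <= e -> 0 < x ->
  `|expR (- (e * x)) * f x| <= `|f x|.
Proof.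
move=> e0 x0; rewrite normrM ler_piMl// ger0_norm ?expR_ge0//.
by rewrite expR_le1 oppr_le0 mulr_ge0// ltW.
Qed.

Lemma integrable_expRN_M e (f : R -> R) : 0 <= e -> continuous f ->
  mu.-integrable `]0, +oo[ (EFin \o f) ->
  mu.-integrable `]0, +oo[ (EFin \o (fun x => expR (- (e * x)) * f x)).
Proof.
move=> e0 cf fi.
apply: (@dominated_integrable_real _ _ R mu _ mD _ (fun x => `|f x|)) => //.
- exact: measurable_expRN_M.
- exact: integrable_norm.
- by move=> x /=; rewrite in_itv/= andbT => x0; exact: normr_expRN_M.
Qed.

(** The kernel is replaced by its defining integral and the order exchanged, e^{- e x} supplying the
    integrability in x; the inner integral is then explicit. *)
Lemma Rintegral_poisson_stable_kernel a p q z k e : 1 < a -> 0 < p -> 0 < e ->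
  \int[mu]_(x in `]0, +oo[) (expR (- (e * x)) *
    (cos (z * x + k) * stable_kernel a p q x +
     cos (z * - x + k) * stable_kernel a p q (- x))) =
  pi^-1 * \int[mu]_(y in `]0, +oo[)
    (poisson_kernel e (z + y) * damped_wave a p q k (- y) +
     poisson_kernel e (z - y) * damped_wave a p q k y).
Proof.
move=> a1 p0 e0.
pose f x y := expR (- (e * x)) * expR (- (p * y `^ a)) *
     (cos (z * x + k) * cos (x * y + q * y `^ a) +
      cos (- (z * x) + k) * cos (- (x * y) + q * y `^ a)).
have iK x := integrable_stable_kernel q x a1 p0.
have fE1 x : \int[mu]_(y in `]0, +oo[) f x y = pi * (expR (- (e * x)) *
    (cos (z * x + k) * stable_kernel a p q x +
     cos (z * - x + k) * stable_kernel a p q (- x))).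
  rewrite /stable_kernel.
  transitivity (expR (- (e * x)) * (cos (z * x + k) *
     \int[mu]_(g in `]0, +oo[) (expR (- (p * g `^ a)) * cos (x * g + q * g `^ a)) +
     cos (z * - x + k) *
     \int[mu]_(g in `]0, +oo[) (expR (- (p * g `^ a)) * cos (- x * g + q * g `^ a)))).
    rewrite -!RintegralZl// -RintegralD//; [|exact: integrable_lamZ|exact: integrable_lamZ].
    rewrite -RintegralZl//; last first.
      by apply: integrable_lamD => //; exact: integrable_lamZ.
    apply: eq_Rintegral => y _; rewrite /f mulNr mulrN; ring.
  have pn0 : (pi : R) != 0 by rewrite gt_eqF ?pi_gt0.
  by move: pn0; move: (pi : R) => P P0; field.
have fE2 y : 0 < y -> \int[mu]_(x in `]0, +oo[) f x y =
    poisson_kernel e (z + y) * damped_wave a p q k (- y) +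
     poisson_kernel e (z - y) * damped_wave a p q k y.
  move=> y0; rewrite damped_waveN_gt0E// damped_wave_gt0E//.
  rewrite -!Rintegral_expRN_cos// mulrC [X in _ = _ + X]mulrC.
  have i1 := integrable_expRN_cos (z + y) e0.
  have i2 := integrable_expRN_cos (z - y) e0.
  rewrite -!RintegralZl// -RintegralD//; [|exact: integrable_lamZ|exact: integrable_lamZ].
  apply: eq_Rintegral => x _; rewrite /f cos_fold mulrDl mulrBl (mulrC x y); ring.
transitivity (pi^-1 * \int[mu]_(x in `]0, +oo[) \int[mu]_(y in `]0, +oo[) f x y).
  under [in RHS]eq_Rintegral do rewrite fE1.
  have cf := @continuous_cos_kernel a p q z k a1 p0.
  have fi := @integrable_cos_kernel a p q z k a1 p0.
  rewrite RintegralZl ?mulKf ?gt_eqF ?pi_gt0//.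
  exact: (integrable_expRN_M (ltW e0) (continuous_fold cf) (integrable_lam_fold cf fi)).
congr (_ * _).
rewrite (@Rintegral_half_line_Fubini _ f (fun x => 2 * expR (- (e * x)))
   (fun y => expR (- (p * y `^ a)) * 1)).
- by apply: eq_Rintegral => y /[!inE]/=; rewrite in_itv/= andbT; exact: fE2.
- exact: measurable_kernel_integrand.
- by apply: integrable_lamZ => //; exact: integrable_expRN.
- apply: (@integrable_expR_powR_bounded _ _ _ 0 (fun=> 1) 1 a1 p0).
    by move=> *; exact: cst_continuous.
  by move=> *; rewrite normr1 mul0r expR0 mul1r.
- move=> x y x0 y0; rewrite /f normrM mulr1 ger0_norm ?mulr_ge0 ?expR_ge0//.
  rewrite mulrC -mulrA ler_wpM2r ?mulr_ge0 ?expR_ge0//.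
  rewrite (le_trans (ler_normD _ _))// -[2]/(1 + 1) !normrM.
  by rewrite lerD// mulr_ile1 ?cos_max.
Qed.

(** Both sides of the smoothed identity converge along e = 1 / (n + 1): the left one because the
    kernel is integrable, the right one as an approximate identity at z. Uniqueness of the limit
    concludes. *)
Lemma stable_kernel_fourier_inversion a p q z k : 1 < a -> 0 < p ->
  \int[mu]_x (cos (z * x + k) * stable_kernel a p q x) = damped_wave a p q k z.
Proof.
move=> a1 p0.
have cf := @continuous_cos_kernel a p q z k a1 p0.
have fi := @integrable_cos_kernel a p q z k a1 p0.
rewrite Rintegral_fold//.
have iD := integrable_lam_fold cf fi.
have cF := continuous_fold cf.
set F := (fun x : R => _ + _) in iD cF *.
have c1 x : `]0, +oo[%classic x -> expR (- (eps n * x)) * F x @[n --> \oo] --> F x.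
  move=> _; rewrite -[X in _ --> X]mul1r; apply: cvgM; last exact: cvg_cst.
  rewrite -expR0; apply: continuous_cvg; first exact: continuous_expR.
  rewrite -oppr0; apply: cvgN; rewrite -(mul0r x).
  by apply: cvgM; [exact: cvg_invSn|exact: cvg_cst].
have b1 n x : `]0, +oo[%classic x -> `|expR (- (eps n * x)) * F x| <= `|F x|.
  by rewrite /= in_itv/= andbT => x0; apply: normr_expRN_M => //; exact: ltW.
have [_ h1] := @cvg_Rintegral_dominated _ _ R mu _ mD
  (fun n x => expR (- (eps n * x)) * F x) F (fun x => `|F x|)
  (fun n => measurable_expRN_M (eps n) cF) c1 (integrable_norm iD) b1.
have E n := Rintegral_poisson_stable_kernel q z k a1 p0 (eps_gt0 n).
have {}h1 : pi^-1 * \int[mu]_(x in `]0, +oo[)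
   (poisson_kernel (eps n) (z + x) * damped_wave a p q k (- x) +
     poisson_kernel (eps n) (z - x) * damped_wave a p q k x) @[n --> \oo] -->
   \int[mu]_(x in `]0, +oo[) F x.
  by under eq_fun do rewrite -E; exact: h1.
have [C C0 HC] := damped_wave_Lipschitz q k z a1 p0.
have cw := @continuous_damped_wave a p q k a1 p0.
have cwN x : {for x, continuous (fun x => damped_wave a p q k (- x))}.
  by apply: continuous_lam_comp; [exact: opp_continuous|exact: cw].
have h2 := @cvg_poisson_integral (damped_wave a p q k) z C (fun x _ => cw x) (fun x _ => cwN x) (fun y => damped_wave_le1 _ _ _ _ p0) C0 HC.
have h3 : pi^-1 * \int[mu]_(x in `]0, +oo[)
   (poisson_kernel (eps n) (z + x) * damped_wave a p q k (- x) +
     poisson_kernel (eps n) (z - x) * damped_wave a p q k x) @[n --> \oo]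
   --> pi^-1 * (pi * damped_wave a p q k z).
  by apply: cvgM; [exact: cvg_cst|exact: h2].
rewrite mulKf ?gt_eqF ?pi_gt0// in h3.
apply: (cvg_unique _ h1 h3) => //.
Qed.

End fourier_inversion.

(** * The fundamental solution *)

Section complex_valued.
Set Implicit Arguments.
Unset Strict Implicit.
Context (R : realType).
Local Open Scope complex_scope.

Lemma normc_le_add (x y : R) : `|x +i* y| <= (`|x| + `|y|)%:C.
Proof.
rewrite normc_def lecR /= -[leRHS]ger0_norm ?addr_ge0// -sqrtr_sqr.
rewrite ler_wsqrtr// sqrrD !real_normK ?num_real// addrAC lerDl.
by rewrite mulrn_wge0// mulr_ge0.
Qed.

Lemma cvg_complex (T : Type) (F : set_system T) {FF : Filter F}
    (f g : T -> R) (l m : R) :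
  f x @[x --> F] --> l -> g x @[x --> F] --> m ->
  f x +i* g x @[x --> F] --> (l +i* m : R[i]^o).
Proof.
move=> fl gm; apply/(@cvgrPdist_le R[i] R[i]^o) => -[e e'].
(* The radius is itself an element of [R[i]], and 0 < e forces its imaginary part to be 0. *)
rewrite ltcE/= => /andP[/eqP -> e0].
have e20 : 0 < e / 2 by rewrite divr_gt0.
have {}fl := (@cvgrPdist_le _ _ _ F FF f l).1 fl _ e20.
have {}gm := (@cvgrPdist_le _ _ _ F FF g m).1 gm _ e20.
apply: filterS2 fl gm => x fx gx.
apply: (le_trans (normc_le_add _ _)).
by rewrite lecR (splitr e) lerD.
Qed.

Lemma is_derive_cvg (f : R -> R) (t l : R) : is_derive t 1 f l ->
  h^-1 * (f (t + h) - f t) @[h --> 0^'] --> l.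
Proof.
move=> [df <-]; rewrite /derivable in df.
apply: cvg_trans df; apply: near_eq_cvg; near=> h.
by rewrite /= [h%:A]mulr1 [h + t]addrC.
Unshelve. all: by end_near. Qed.

End complex_valued.

(** * The transform of the solution and its evolution in time *)

Section solution.
Set Implicit Arguments.
Unset Strict Implicit.
Context (R : realType) (alpha theta : R).
Context (theta_gt0 : 0 < theta) (theta_lt1 : theta < 1)
  (alpha_gt1 : 1 < alpha) (alpha_theta_gt1 : 1 < alpha * theta).
Notation mu := (@lebesgue_measure R).
Notation a := (alpha * theta).
Notation phi := (pi * theta / 2).
Local Open Scope complex_scope.

Let c_gt0 : 0 < cos phi. Proof. exact: cos_phi_gt0. Qed.

Definition symbol_Re (g : R) := - (`|g| `^ a * cos phi).
Definition symbol_Im (g : R) := - (sin phi * signed_powR a g).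

Definition propagator (g t : R) : R[i] :=
  (expR (t * symbol_Re g) * cos (t * symbol_Im g)) +i*
  (expR (t * symbol_Re g) * sin (t * symbol_Im g)).

Lemma riesz_feller_symbolE g :
  riesz_feller_symbol a theta g = symbol_Re g +i* symbol_Im g.
Proof.
have a0 : a != 0 by rewrite gt_eqF// (lt_trans ltr01).
rewrite /riesz_feller_symbol /expi /symbol_Re /symbol_Im /signed_powR (mulrC phi).
have [->|g0] := eqVneq g 0.
  rewrite normr0 powR0// mul0r sgr0 mul0r !mulr0 oppr0.
  by apply/eqP; rewrite eq_complex/= !(oppr0, mul0r, mulr0, subr0, addr0) eqxx.
rewrite cos_sg// sin_sg; apply/eqP; rewrite eq_complex/= !(oppr0, mul0r, mulr0, subr0, addr0).
by apply/andP; split; apply/eqP; ring.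
Qed.

Lemma fourier_u_sol g t : 0 < t ->
  fourier (fun x => u_sol alpha theta x t) g = propagator g t.
Proof.
move=> t0; have p0 : 0 < t * cos phi by rewrite mulr_gt0.
have -> : (fun x => u_sol alpha theta x t) = stable_kernel a (t * cos phi) (t * sin phi).
  by apply/funext => x; rewrite u_solE.
have inv k := stable_kernel_fourier_inversion (t * sin phi) g k alpha_theta_gt1 p0.
have E1 : expR (t * symbol_Re g) = expR (- (t * cos phi * `|g| `^ a)).
  by congr expR; rewrite /symbol_Re; ring.
rewrite /fourier /Cintegral /propagator E1.
congr (_ +i* _).
  rewrite (_ : cos (t * symbol_Im g) = cos (0 - t * sin phi * signed_powR a g)); last first.
    by congr cos; rewrite /symbol_Im; ring.
  rewrite -[RHS]/(damped_wave _ _ _ _ _) -inv; apply: eq_Rintegral => x _.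
  by rewrite /= mulr0 subr0 addr0.
(* The phase - pi / 2 extracts the imaginary part from the same inversion formula. *)
rewrite (_ : sin (t * symbol_Im g) = cos (- (pi / 2) - t * sin phi * signed_powR a g)); last first.
  rewrite -cosBpihalf; congr cos; rewrite /symbol_Im; ring.
rewrite -[RHS]/(damped_wave _ _ _ _ _) -inv; apply: eq_Rintegral => x _.
by rewrite /= mulr0 add0r cosBpihalf.
Qed.

Lemma propagator_has_Cderivative g t :
  has_Cderivative (propagator g) t (riesz_feller_symbol a theta g * propagator g t).
Proof.
rewrite riesz_feller_symbolE /has_Cderivative /propagator.
set u := symbol_Re g; set v := symbol_Im g.
pose fR s := expR (s * u) * cos (s * v).
pose fI s := expR (s * u) * sin (s * v).
have dR : is_derive t 1 fR (u * fR t - v * fI t).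
  by rewrite /fR /fI; derive_to_eq => /=; ring.
have dI : is_derive t 1 fI (u * fI t + v * fR t).
  by rewrite /fR /fI; derive_to_eq => /=; ring.
rewrite (_ : _ * _ = (u * fR t - v * fI t) +i* (u * fI t + v * fR t))//.
apply: cvg_trans (cvg_complex (is_derive_cvg dR) (is_derive_cvg dI)).
apply: near_eq_cvg; near=> h.
by apply/eqP; rewrite eq_complex/= !mul0r subr0 addr0 !eqxx.
Unshelve. all: by end_near. Qed.

Lemma cvg_propagator0 g : propagator g t @[t --> 0^'+] --> (1 : R[i]^o).
Proof.
rewrite /propagator; set u := symbol_Re g; set v := symbol_Im g.
have cR : {for 0, continuous (fun s : R => expR (s * u) * cos (s * v))} by solve_continuous.
have cI : {for 0, continuous (fun s : R => expR (s * u) * sin (s * v))} by solve_continuous.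
have := cvg_complex (cvg_at_right_filter cR) (cvg_at_right_filter cI).
by rewrite /= !mul0r expR0 cos0 sin0 mulr1 mulr0; apply.
Qed.

Lemma u_sol_is_fundamental_solution :
  is_fundamental_solution a theta (u_sol alpha theta).
Proof.
split.
- move=> t t0; have p0 : 0 < t * cos phi by rewrite mulr_gt0.
  have := integrable_stable_kernelT (t * sin phi) alpha_theta_gt1 p0.
  by apply: eq_integrable => // x _; rewrite /= u_solE.
- move=> g t t0; rewrite fourier_u_sol//.
  apply: cvg_trans (@propagator_has_Cderivative g t).
  (* The transform is known at positive times only, so h is restricted to |h| < t, which keeps t + h
     > 0. *)
  apply: near_eq_cvg; near=> h; rewrite !fourier_u_sol//.
  have ht : `|h| < t by near: h; exact: dnbhs0_lt.
  by rewrite -ltrBlDl sub0r (lt_le_trans _ (lerNnormlW (lexx _)))// ltrN2.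
- move=> g; apply: cvg_trans (@cvg_propagator0 g).
  apply: near_eq_cvg; near=> t; rewrite fourier_u_sol//.
Unshelve. all: by end_near. Qed.

End solution.

(** The first two clauses certify that the infinite sum and the limit at x = 0 hidden in [u_sol] are
    genuine values and not defaults. *)
Theorem mainTheorem6 (R : realType) (alpha theta : R)
    (theta_gt0 : 0 < theta) (theta_lt1 : theta < 1)
    (alpha_gt1 : 1 < alpha) (alpha_theta_gt1 : 1 < alpha * theta) :
  [/\ (forall x t : R, 0 < t ->
         cvg ((\sum_(1 <= k < n) u_term alpha theta x t k) @[n --> \oo])),
      (forall t : R, 0 < t ->
         (fun x => u_sol alpha theta x t) @ 0
           --> u_sol alpha theta 0 t)
    & is_fundamental_solution (alpha * theta) theta (u_sol alpha theta)].
Proof.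
split; last exact: u_sol_is_fundamental_solution.
- move=> x t t0.
  by have := @cvg_u_term R alpha theta theta_gt0 theta_lt1 alpha_gt1 alpha_theta_gt1 x t t0; exact: cvgP.
- move=> t t0; have -> : (fun x => u_sol alpha theta x t) =
      stable_kernel (alpha * theta) (t * cos (pi * theta / 2)) (t * sin (pi * theta / 2)).
    by apply/funext => x; rewrite u_solE.
  rewrite u_solE//; apply: continuous_stable_kernel => //.
  by rewrite mulr_gt0// cos_phi_gt0.
Qed.
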